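(* For every $n \ge 1$, the polynomial $f^+_n(x)$ is equal to the local $h$-polynomial $\ell_{[n]}(K_n, x)$ of the simplicial subdivision $K_n$ of the simplex $2^{[n]}$. In particular, $f^+_n$ has nonnegative, symmetric and unimodal coefficients. Moreover, for every $n \in \mathbb{N}$, $$ f^+_n(x) = \sum_{k=0}^n (-1)^{n-k} \binom{n}{k} B^+_k(x) \quad\text{and}\quad f^-_n(x) = \sum_{k=0}^n (-1)^{n-k} \binom{n}{k} B^-_k(x). $$
   Context: Signed permutations: a signed permutation of $[n]$ is a set $S = \{a_1, \dots, a_n\}$ with $a_i \in \{i, -i\}$, together with a bijection $w : S \to S$, written as the word $w(a_1) \cdots w(a_n)$. The set of these is $B_n$. - An index $i \in \{0, \dots, n-1\}$ is a $B$-descent if $w(a_i) > w(a_{i+1})$, with the convention $w(a_0) = 0$; $\mathrm{des}_B(w)$ is the number of $B$-descents. - $B^+_n$ (resp. $B^-_n$) is the set of $w \in B_n$ with $w(a_n) > 0$ (resp. $< 0$). - $B^\pm_n(x) = \sum_{w \in B^\pm_n} x^{\mathrm{des}_B(w)}$, with $B^+_0(x) = 1$ and $B^-_0(x) = 0$. - $a \in S$ is a $B$-excedance if $w(a) > a$, or if $a < 0$ and $w(a) = a$. - $w$ is a derangement if no $a \in S$ with $a > 0$ satisfies $w(a) = a$. - $d^B_n(x) = \sum_{w \text{ derangement}} x^{\mathrm{exc}_B(w)}$, with $d^B_0 = 1$. - $f^+_n, f^-_n$ are the unique real polynomials with $d^B_n = f^+_n + f^-_n$, $f^+_n(x) = x^n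 f^+_n(1/x)$ and $f^-_n(x) = x^{n+1} f^-_n(1/x)$. Face enumeration: for a simplicial complex $\Delta$ of dimension $d-1$, the $h$-polynomial is $h(\Delta, x) = \sum_{F \in \Delta} x^{|F|} (1-x)^{d-|F|}$. Subdivisions: a simplicial subdivision of the simplex $2^V$ (with $|V| = d$) is a simplicial complex $\Gamma$ with a map $\sigma : \Gamma \to 2^V$ such that, for every $F \subseteq V$, the restriction $\Gamma_F = \sigma^{-1}(2^F)$ is a subcomplex homeomorphic to a ball of dimension $|F|-1$ whose interior is $\sigma^{-1}(F)$. Its local $h$-polynomial is $$ \ell_V(\Gamma, x) = \sum_{F \subseteq V} (-1)^{d-|F|}\, h(\Gamma_F, x). $$ $K_n$: let $P$ be the set of intervals $[A, B]$ with $\emptyset \ne A \subseteq B \subseteq [n]$ (intervals in the Boolean lattice), ordered by inclusion: $[A, B] \le [A', B']$ iff $A' \subseteq A$ and $B \subseteq B'$. $K_n$ is the order complex of $P$, i.e. the simplicial complex of chains of $P$. It is a simplicial subdivision of $2^{[n]}$ via the carrier map sending a nonempty chain to the set $B$ of its largest element $[A, B]$, and the empty chain to $\emptyset$. *)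

(* Defs.v *)
From HB Require Import structures.
From mathcomp Require Import all_boot all_order all_algebra all_fingroup.
Set Implicit Arguments. Unset Strict Implicit. Unset Printing Implicit Defensive.
Import Order.TTheory GRing.Theory Num.Theory.
Local Open Scope ring_scope.

(* ---------------- Signed permutations ----------------
   A signed permutation of [n] is a set S = {a_1..a_n}, a_i in {i,-i},
   with a bijection w : S -> S.  S is encoded by eps : {ffun 'I_n -> bool}
   (eps i = true iff a_{i+1} = -(i+1)), and w by a permutation s of 'I_n,
   with w(a_{i+1}) = a_{s(i)+1}.  Index i : 'I_n stands for the 1-based i+1. *)

Definition selt n (eps : {ffun 'I_n -> bool}) (i : 'I_n) : int :=
  if eps i then - (i.+1 : int) else (i.+1 : int).

Definition wval n (eps : {ffun 'I_n -> bool}) (s : {perm 'I_n}) (i : 'I_n) : int :=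
  selt eps (s i).

Definition wword n (eps : {ffun 'I_n -> bool}) (s : {perm 'I_n}) : seq int :=
  [seq wval eps s i | i <- enum 'I_n].

Definition desB n (eps : {ffun 'I_n -> bool}) (s : {perm 'I_n}) : nat :=
  let ws := (0 : int) :: wword eps s in
  #|[set i : 'I_n | nth 0 ws i.+1 < nth 0 ws i]|.

Definition Bplus (R : nzRingType) (n : nat) : {poly R} :=
  if n is 0 then 1 else
  \sum_(eps : {ffun 'I_n -> bool})
     \sum_(s : {perm 'I_n} | 0 < last 0 (wword eps s)) 'X^(desB eps s).

Definition Bminus (R : nzRingType) (n : nat) : {poly R} :=
  if n is 0 then 0 else
  \sum_(eps : {ffun 'I_n -> bool})
     \sum_(s : {perm 'I_n} | last 0 (wword eps s) < 0) 'X^(desB eps s).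

Definition excB n (eps : {ffun 'I_n -> bool}) (s : {perm 'I_n}) : nat :=
  #|[set i : 'I_n | (selt eps i < wval eps s i)
                   || ((selt eps i < 0) && (wval eps s i == selt eps i))]|.

Definition derangementB n (eps : {ffun 'I_n -> bool}) (s : {perm 'I_n}) : bool :=
  [forall i : 'I_n, (0 < selt eps i) ==> (wval eps s i != selt eps i)].

Definition dB (R : nzRingType) (n : nat) : {poly R} :=
  \sum_(eps : {ffun 'I_n -> bool})
     \sum_(s : {perm 'I_n} | derangementB eps s) 'X^(excB eps s).

Definition symm_deg (R : fieldType) (m : nat) (p : {poly R}) : Prop :=
  forall x : R, x != 0 -> p.[x] = x ^+ m * p.[x^-1].

Definition ivl n := ({set 'I_n} * {set 'I_n})%type.

Definition is_ivl n (I : ivl n) : bool := (I.1 != set0) && (I.1 \subset I.2).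

Definition ivl_le n (I J : ivl n) : bool := (J.1 \subset I.1) && (I.2 \subset J.2).

(* faces of K_n: chains of P (including the empty chain) *)
Definition is_chain n (c : {set ivl n}) : bool :=
  [forall I in c, is_ivl I] &&
  [forall I in c, forall J in c, ivl_le I J || ivl_le J I].

Definition carrier n (c : {set ivl n}) : {set 'I_n} :=
  if [pick I in c | [forall J in c, ivl_le J I]] is Some K then K.2 else set0.

Definition KnRestr n (F : {set 'I_n}) : {set {set ivl n}} :=
  [set c | is_chain c && (carrier c \subset F)].

(* h-polynomial of a complex with face set D; d = max face size = dim + 1 *)
Definition hpoly (R : nzRingType) (T : finType) (D : {set {set T}}) : {poly R} :=
  let d := (\max_(c in D) #|c|)%N in
  \sum_(c in D) 'X^#|c| * (1 - 'X) ^+ (d - #|c|).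

Definition localh_Kn (R : nzRingType) (n : nat) : {poly R} :=
  \sum_(F : {set 'I_n}) (-1) ^+ (n - #|F|) * hpoly R (KnRestr F).

Definition unimodal_coefs (R : numDomainType) (p : {poly R}) : Prop :=
  exists k : nat,
    (forall i j : nat, (i <= j <= k)%N -> p`_i <= p`_j) /\
    (forall i j : nat, (k <= i <= j)%N -> p`_j <= p`_i).

(* Main.v *)
(* Write u = 1 - x. Both the B-descent enumerators of signed words and the
   h-polynomials of K_n obey the same recursions: expanding x^[a > b] as
   x + u [a < b] cuts a word into increasing runs, and a run is a set of signed
   letters, while a chain of intervals is peeled off at its top element. This
   gives B_n = B^+_n + B^-_n the exponential generating function
   u e^(ut) / (1 - x e^(2ut)), and B^+_n, for n >= 1 equal to h(K_n, x), the function
   (e^(ut) - x e^(2ut)) / (1 - x e^(2ut)). Following the cycle of the largest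
   element, the same expansion computes the type A derangement polynomials
   d_n, with generating function u / (e^(xt) - x e^t); choosing the negative
   fixed points and the signs of the others turns it into e^(xt) d(2t) for d^B_n.
   Hence binomial inversion of B^+_n and B^-_n yields f^+ = N(t) / N(2t) and
   f^- = A f^+, where N(t) = e^(xt) - x e^t and A = x (e^t - e^(xt)) / N(t)
   satisfies A' = x + (1 + x) A + A^2, while (f^+)' = (2 A(2t) - A(t)) f^+. These
   two differential equations are recursions with nonnegative coefficients, so
   the coefficients of A, f^+ and f^- lie in the cones spanned by the
   x^i (1 + x)^j; symmetry and unimodality follow. *)
Require Import Defs.
From HB Require Import structures.
From mathcomp Require Import all_boot all_order all_algebra all_fingroup.
From Stdlib Require Import FunctionalExtensionality Ring_theory Ring.

(* Later imports rebind [ring] to the mathcomp version, which needs a canonical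
   ring; sequences only carry a Stdlib [ring_theory]. *)
Tactic Notation "conv_ring" := ring.

From mathcomp Require Import ring zify.
Set Implicit Arguments. Unset Strict Implicit. Unset Printing Implicit Defensive.
Import Order.TTheory GRing.Theory Num.Theory.
Local Open Scope ring_scope.

(** * Binomial convolution of sequences *)

Section Recursion.
Variables (T : Type) (a0 : T) (Phi : (nat -> T) -> nat -> T).
Hypothesis causal : forall f g n, (forall k, (k <= n)%N -> f k = g k) ->
  Phi f n = Phi g n.

(** Each table is correct up to index [n] and repeats its last value beyond; [causal] makes that
    filler harmless. *)
Fixpoint course_table n : nat -> T :=
  if n is m.+1 then fun k => if (k <= m)%N then course_table m k
                             else Phi (course_table m) m
  else fun _ => a0.

Definition course n := course_table n n.

Lemma course_tableE n k : (k <= n)%N -> course_table n k = course k.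
Proof.
elim: n => [|n IHn]; first by rewrite leqn0 => /eqP->.
by rewrite leq_eqVlt => /predU1P[->//|lt_kn] /=; rewrite -ltnS lt_kn IHn.
Qed.

Lemma courseS n : course n.+1 = Phi course n.
Proof. by rewrite /course /= ltnn; apply: causal => k; apply: course_tableE. Qed.

End Recursion.

Section Conv.
Variable A : comNzRingType.
Implicit Types (f g h : nat -> A) (a b c : A).

(* A sequence f stands for the exponential generating function
   sum f_n t^n / n!: [conv] is the product, [shift] is d/dt, [cst c] the constant c,
   [geo a] is e^(at), and [dilate] substitutes 2t for t. *)
Definition conv f g n : A := \sum_(k < n.+1) 'C(n, k)%:R * f k * g (n - k)%N.
Definition shift f n : A := f n.+1.
Definition sadd f g n : A := f n + g n.
Definition sopp f n : A := - f n.
Definition ssub f g n : A := f n - g n.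
Definition cst c n : A := if n is 0 then c else 0.
Definition geo a n : A := a ^+ n.
Definition dilate f n : A := 2 ^+ n * f n.

Lemma conv_0 f g : conv f g 0 = f 0%N * g 0%N.
Proof. by rewrite /conv big_ord1 bin0 mul1r. Qed.

(** Pascal's rule makes [shift] a derivation of [conv]; commutativity and associativity then follow
    by induction on the index. *)
Lemma conv_S f g n : conv f g n.+1 = conv (shift f) g n + conv f (shift g) n.
Proof.
rewrite /conv big_ord_recl /= bin0 mul1r subn0.
under eq_bigr => i _ do rewrite /bump /= add1n binS natrD 2!mulrDl subSS.
rewrite big_split /= addrA addrC; congr (_ + _).
rewrite [in RHS]big_ord_recl /= bin0 mul1r subn0; congr (_ + _).
rewrite big_ord_recr /= bin_small // !mul0r addr0.
by apply: eq_bigr => i _; rewrite /bump /= add1n /shift -subSn.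
Qed.

Lemma seqP f g : f 0%N = g 0%N -> shift f = shift g -> f = g.
Proof.
move=> e0 eS; apply: functional_extensionality => -[//|n].
exact: (congr1 (@^~ n) eS).
Qed.

Lemma shift_conv f g : shift (conv f g) = sadd (conv (shift f) g) (conv f (shift g)).
Proof. by apply: functional_extensionality => n; apply: conv_S. Qed.

Lemma convC f g : conv f g = conv g f.
Proof.
apply: functional_extensionality => n.
elim: n f g => [|n IHn] f g; first by rewrite !conv_0 mulrC.
by rewrite !conv_S addrC IHn [in X in _ + X]IHn.
Qed.

Lemma convDl f g h : conv (sadd f g) h = sadd (conv f h) (conv g h).
Proof.
apply: functional_extensionality => n; rewrite /conv /sadd -big_split /=.
by apply: eq_bigr => i _; rewrite mulrDr mulrDl.
Qed.

Lemma convDr f g h : conv f (sadd g h) = sadd (conv f g) (conv f h).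
Proof. by rewrite convC convDl !(convC f). Qed.

Lemma convA f g h : conv f (conv g h) = conv (conv f g) h.
Proof.
apply: functional_extensionality => n.
elim: n f g h => [|n IHn] f g h; first by rewrite !conv_0 mulrA.
rewrite !conv_S !shift_conv convDl convDr /sadd.
by rewrite !IHn addrA.
Qed.

Lemma conv_cst c f n : conv (cst c) f n = c * f n.
Proof.
rewrite /conv big_ord_recl bin0 subn0 /= mul1r big1 ?addr0 // => i _.
by rewrite mulr0 mul0r.
Qed.

Lemma conv1 f : conv (cst 1) f = f.
Proof. by apply: functional_extensionality => n; rewrite conv_cst mul1r. Qed.

Lemma seq_ring_theory :
  ring_theory (cst 0) (cst 1) sadd conv ssub sopp eq.
Proof.
split; rewrite /sadd /sopp /ssub //.
- by move=> f; apply: functional_extensionality => -[|n]; rewrite add0r.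
- by move=> f g; apply: functional_extensionality => n; rewrite addrC.
- by move=> f g h; apply: functional_extensionality => n; rewrite addrA.
- exact: conv1.
- exact: convC.
- exact: convA.
- exact: convDl.
- by move=> f; apply: functional_extensionality => -[|n]; rewrite subrr.
Qed.

Lemma shift_cst c : shift (cst c) = cst 0.
Proof. by apply: functional_extensionality => -[|n]. Qed.

Lemma shift_geo a : shift (geo a) = conv (cst a) (geo a).
Proof.
by apply: functional_extensionality => n; rewrite conv_cst /shift /geo exprS.
Qed.

Lemma shift_sub f g : shift (ssub f g) = ssub (shift f) (shift g). Proof. by []. Qed.

Lemma conv_geo a b : conv (geo a) (geo b) = geo (a + b).
Proof.
apply: functional_extensionality => n; rewrite /conv /geo addrC exprDn.
by apply: eq_bigr => i _; rewrite mulrAC -mulrA mulr_natl mulrC.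
Qed.

Lemma geo0 : geo 0 = cst 1.
Proof. by apply: functional_extensionality => -[|n]; rewrite /geo expr0n. Qed.

Lemma dilate_conv f g : dilate (conv f g) = conv (dilate f) (dilate g).
Proof.
apply: functional_extensionality => n; rewrite /dilate /conv mulr_sumr.
apply: eq_bigr => -[k /= le_kn] _.
by rewrite -{1}(subnK (ltnSE le_kn)) exprD; ring.
Qed.

Lemma dilate_sub f g : dilate (ssub f g) = ssub (dilate f) (dilate g).
Proof. by apply: functional_extensionality => n; rewrite /dilate mulrBr. Qed.

Lemma dilate_cst c : dilate (cst c) = cst c.
Proof.
by apply: functional_extensionality => -[|n]; rewrite /dilate ?mul1r ?mulr0.
Qed.

Lemma dilate_geo a : dilate (geo a) = conv (geo a) (geo a).
Proof.
rewrite conv_geo; apply: functional_extensionality => n.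
by rewrite /dilate /geo -mulr2n -(mulr_natl a 2) exprMn.
Qed.

Lemma cst_sub a b : cst (a - b) = ssub (cst a) (cst b).
Proof.
by apply: functional_extensionality => -[|n]; rewrite /ssub ?subr0.
Qed.

Lemma cst2 : cst 2 = sadd (cst 1) (cst 1).
Proof. by apply: functional_extensionality => -[|n]; rewrite /sadd ?addr0. Qed.

Lemma ssub_eq0 f g : ssub f g = cst 0 -> f = g.
Proof.
move=> fg0; apply: functional_extensionality => n; apply/eqP.
by rewrite -subr_eq0 -/(ssub f g n) fg0; case: n.
Qed.

(** Coefficient n + 1 of z is a combination of z_0, ..., z_n. Series are identified below by showing
    that their difference solves such an equation. *)
Lemma linear_ode0 f z : z 0%N = 0 -> shift z = conv f z -> z = cst 0.
Proof.
move=> z0 zS; apply: functional_extensionality => n.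
have -> : cst 0 n = 0 :> A by case: n.
elim/ltn_ind: n => -[//|n] IHn; rewrite -[z n.+1]/(shift z n) zS /conv.
by rewrite big1 // => k _; rewrite IHn ?mulr0 // ltnS leq_subr.
Qed.

Lemma eq_conv f f' g g' n : (forall k, (k <= n)%N -> f k = f' k) ->
  (forall k, (k <= n)%N -> g k = g' k) -> conv f g n = conv f' g' n.
Proof.
move=> eqf eqg; apply: eq_bigr => -[k /= lt_kn] _.
by rewrite eqf ?eqg // leq_subr.
Qed.

End Conv.

(** By strong induction only the terms with factor [f 0] remain to be compared. This replaces
    division by series whose constant term is a power of 1 - x. *)
Lemma conv_cancel (A : idomainType) (f g h : nat -> A) :
  f 0%N != 0 -> conv f g = conv f h -> g = h.
Proof.
move=> f0 eq_fgh; apply: functional_extensionality.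
apply: ltn_ind => n IHn; apply: (mulfI f0).
have := congr1 (@^~ n) eq_fgh; rewrite /conv !big_ord_recl bin0 !mul1r subn0.
rewrite [X in _ + X](eq_bigr (fun i : 'I_n =>
  'C(n, bump 0 i)%:R * f (bump 0 i) * h (n - bump 0 i)%N)); first exact: addIr.
move=> i _; rewrite IHn //.
by rewrite lift0 -subSn ?ltn_ord // subSS leq_subr.
Qed.

(* Weight of a run of k letters when x^[a > b] is split as x + (1 - x) [a < b]:
   one factor x at its boundary, 1 - x inside it, and a^k choices of signs. *)
Definition run (A : comNzRingType) (x a : A) (k : nat) : A :=
  if k is k'.+1 then a ^+ k * x * (1 - x) ^+ k' else 0.

(** * Identities between exponential generating functions *)

Section Identities.
Variables (A : idomainType) (x : A).
Hypothesis x1 : 1 - x != 0.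
Let u := 1 - x.

Add Ring conv_ring : (@seq_ring_theory A).

Local Notation E := (@geo A).
Local Notation c := (@cst A).
Local Notation run := (@run A x).
Local Notation "f ** g" := (conv f g) (at level 40, left associativity).
Local Notation "f ++ g" := (sadd f g).
Local Notation "f -- g" := (ssub f g) (at level 50, left associativity).

Let N := E x -- c x ** E 1.
Let M := c x ** (E 1 -- E x).

Let shN : shift N = c 0 -- M.
Proof.
rewrite /N /M shift_sub shift_conv !shift_geo shift_cst; conv_ring.
Qed.

Let shM : shift M = c x ** N ++ (c 1 ++ c x) ** M.
Proof.
rewrite /N /M shift_conv shift_sub !shift_geo shift_cst; conv_ring.
Qed.

(* Solves A' = x + (1 + x) A + A^2, A(0) = 0: these are the Eulerian polynomials
   (times x, and with value 0 at n = 0). *)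
Definition eulerian := course 0 (fun f n => c x n + (1 + x) * f n + (f ** f) n).

Lemma eulerianS n : eulerian n.+1 = c x n + (1 + x) * eulerian n + (eulerian ** eulerian) n.
Proof.
by rewrite /eulerian courseS // => f g m eqfg; rewrite (eq_conv eqfg eqfg) eqfg.
Qed.

Lemma shift_eulerian :
  shift eulerian = c x ++ (c 1 ++ c x) ** eulerian ++ eulerian ** eulerian.
Proof.
apply: functional_extensionality => n; rewrite /shift eulerianS.
by rewrite convDl conv1 /sadd conv_cst mulrDl mul1r !addrA.
Qed.

Lemma eulerian_N : eulerian ** N = M.
Proof.
have Z : eulerian ** N -- M = c 0.
  (* By the Riccati equation for A, the difference z = A N - M satisfies z' = (1 + x + A) z. *)
  apply: (@linear_ode0 _ (c 1 ++ c x ++ eulerian)).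
    by rewrite /M /ssub !conv_0 /= /ssub /= /geo !expr0 /cst subrr mulr0 mul0r subr0.
  rewrite shift_sub shift_conv shN shM shift_eulerian; conv_ring.
exact: ssub_eq0.
Qed.

(* (1 - x) / (e^(xt) - x e^t), the derangement polynomials of type A. *)
Definition derange := course 1 (fun f n => (eulerian ** f) n).

Lemma shift_derange : shift derange = eulerian ** derange.
Proof.
apply: functional_extensionality => n; rewrite /shift /derange courseS // => f g m eqfg.
exact: eq_conv.
Qed.

Lemma N_derange : N ** derange = c u.
Proof.
have -> : u = (N ** derange) 0%N.
  by rewrite conv_0 /N /ssub conv_0 /= /geo !expr0 !mulr1.
apply: seqP => //; rewrite shift_cst shift_conv shN shift_derange -eulerian_N; conv_ring.
Qed.

(* (e^(xt) - x e^t) / (e^(2xt) - x e^(2t)), given by the recursion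
   f'(t) = (2 A(2t) - A(t)) f(t), whose coefficients 2^(k+1) - 1 are positive. *)
Definition local_h :=
  course 1 (fun f n => ((c 2 ** dilate eulerian -- eulerian) ** f) n).

Lemma shift_local_h : shift local_h = (c 2 ** dilate eulerian -- eulerian) ** local_h.
Proof.
apply: functional_extensionality => n; rewrite /shift /local_h courseS // => f g m eqfg.
exact: eq_conv.
Qed.

Let D := E x ** E x -- c x ** (E 1 ** E 1).

Let dilN : dilate N = D.
Proof. by rewrite dilate_sub dilate_conv dilate_cst !dilate_geo. Qed.

Let shD : shift D = c 0 -- c 2 ** dilate M.
Proof.
rewrite /D /M dilate_conv dilate_sub dilate_cst !dilate_geo.
rewrite shift_sub !shift_conv !shift_geo shift_cst cst2; conv_ring.
Qed.

Lemma D_local_h : D ** local_h = N.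
Proof.
(* Since A(2t) D = M(2t) and A N = M, the terms in 2t cancel, and z = D f - N satisfies z' = - A
   z. *)
apply: ssub_eq0; apply: (@linear_ode0 _ (c 0 -- eulerian)).
  by rewrite /D /N /ssub !conv_0 /ssub ?conv_0 /= /geo !expr0 !mulr1 subrr.
rewrite shift_sub shift_conv shN shD shift_local_h -eulerian_N dilate_conv dilN; conv_ring.
Qed.

Lemma D_dilate_derange : D ** dilate derange = c u.
Proof. by rewrite -dilN -dilate_conv N_derange dilate_cst. Qed.

(** The series of runs is x (e^(aut) - 1) / u, here cleared of its denominator. *)
Let u_run a : c u ** run a = c x ** (E (a * u) -- c 1).
Proof.
apply: functional_extensionality => -[|n]; rewrite !conv_cst /ssub /geo /=.
  by rewrite expr0 subrr !mulr0.
by rewrite subr0 exprMn !exprS; ring.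
Qed.

(** [conv_ring] treats each exponential as an atom. So e^(ut) is split as e^t e^(-xt), and each
    residual below is first written with explicit factors 1 - e^(xt) e^(-xt), which [E_x] makes
    vanish. *)
Let E_1u : E u = E 1 ** E (- x). Proof. by rewrite conv_geo. Qed.
Let E_2u : E (2 * u) = E 1 ** E 1 ** (E (- x) ** E (- x)).
Proof. by rewrite !conv_geo; congr E; rewrite /u; ring. Qed.
Let E_x : E x ** E (- x) = c 1. Proof. by rewrite conv_geo subrr geo0. Qed.
Let c_u : c u = c 1 -- c x. Proof. exact: cst_sub. Qed.

(** Series form of the recursion [exc_supp_run]: once a run is removed, the largest element is
    either fixed or still moved, whence d + d'. *)
Lemma derange_run : shift derange = run 1 ** (derange ++ shift derange).
Proof.
apply: (@conv_cancel _ (c u ** E x)).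
  by rewrite conv_0 /geo expr0 mulr1.
apply: ssub_eq0.
transitivity (c u ** E x ** shift derange
     -- E x ** (c u ** run 1) ** (derange ++ shift derange)); first by conv_ring.
rewrite u_run mul1r E_1u shift_derange c_u.
transitivity ((N ** eulerian -- M) ** derange
  ++ c x ** E 1 ** (c 1 -- E x ** E (- x)) ** (derange ++ eulerian ** derange)).
  rewrite /N /M; conv_ring.
by rewrite E_x (convC N) eulerian_N; conv_ring.
Qed.

(* The Eulerian polynomials of type B. *)
Definition eulerianB := E 1 ** (E x ** dilate derange).

Let D_eulerianB : D ** eulerianB = c u ** E 1 ** E x.
Proof. rewrite /eulerianB -D_dilate_derange; conv_ring. Qed.

(** This equation is met twice, by chains below an interval and by signed words; it determines the
    series, since [run 2] has no constant term. *)
Lemma eulerianB_run : eulerianB = E u ++ run 2 ** eulerianB.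
Proof.
apply: (@conv_cancel _ (c u ** E x ** E x)).
  by rewrite !conv_0 /geo expr0 !mulr1.
apply: ssub_eq0.
transitivity (c u ** E x ** E x ** (eulerianB -- E u)
     -- E x ** E x ** (c u ** run 2) ** eulerianB); first by conv_ring.
rewrite u_run E_2u E_1u.
transitivity (D ** eulerianB -- c u ** E 1 ** E x
  ++ c u ** E x ** E 1 ** (c 1 -- E x ** E (- x))
  ++ c x ** E 1 ** E 1 ** eulerianB ** (c 1 ++ E x ** E (- x))
     ** (c 1 -- E x ** E (- x))).
  rewrite /D c_u; conv_ring.
rewrite E_x D_eulerianB; conv_ring.
Qed.

(** Here the first factor counts 2^k - 1 choices instead of 2^k: an all-negative last run is
    excluded for words, an empty lower end for chains. *)
Lemma local_h_run : E 1 ** local_h = E u ++ (run 2 -- run 1) ** eulerianB.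
Proof.
apply: (@conv_cancel _ (c u ** E x ** E x ** D)).
  by rewrite !conv_0 /D /ssub ?conv_0 /geo expr0 !mulr1 mulf_neq0.
transitivity (c u ** E x ** E x ** E 1 ** (D ** local_h)); first by conv_ring.
transitivity (c u ** E x ** E x ** D ** E u
     ++ E x ** E x ** (c u ** run 2 -- c u ** run 1) ** (D ** eulerianB)); last first.
  by conv_ring.
rewrite !u_run mul1r E_2u E_1u D_local_h D_eulerianB; apply: ssub_eq0.
transitivity (c u ** E 1 ** E x ** (c 1 -- E x ** E (- x))
  ** (D ++ c x ** E 1 ** E 1 ** (c 1 ++ E x ** E (- x))
      -- c x ** E 1 ** E x)).
  rewrite /N /D; conv_ring.
rewrite E_x; conv_ring.
Qed.

(** Multiplied by D, both sides become (1 - x) e^(xt) = N + M. The two summands on the right are the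
    future f^+ and f^-. *)
Lemma eulerianB_local_h : E x ** dilate derange = local_h ++ eulerian ** local_h.
Proof.
apply: (@conv_cancel _ D).
  by rewrite /D /ssub ?conv_0 /geo expr0 !mulr1.
transitivity (E x ** (D ** dilate derange)); first by conv_ring.
transitivity (D ** local_h ++ eulerian ** (D ** local_h)); last by conv_ring.
rewrite D_dilate_derange D_local_h eulerian_N c_u /N /M; conv_ring.
Qed.

End Identities.

(** * Gamma-positivity *)

Section GammaPositive.
Variable R : realFieldType.
Implicit Types p q : {poly R}.

(** 'X has weight two and 1 + 'X weight one, so the index is twice the centre of symmetry. *)
Inductive gamma_pos : nat -> {poly R} -> Prop :=
| gamma_pos0 n : gamma_pos n 0
| gamma_posC c : 0 <= c -> gamma_pos 0 c%:P
| gamma_posX n p : gamma_pos n p -> gamma_pos n.+2 ('X * p)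
| gamma_pos1X n p : gamma_pos n p -> gamma_pos n.+1 ((1 + 'X) * p)
| gamma_posD n p q : gamma_pos n p -> gamma_pos n q -> gamma_pos n (p + q).

Lemma gamma_posZ n c p : 0 <= c -> gamma_pos n p -> gamma_pos n (c%:P * p).
Proof.
move=> c0; elim=> {n p} [n|d d0|n p _ IH|n p _ IH|n p q _ IHp _ IHq].
- by rewrite mulr0; constructor.
- by rewrite -polyCM; constructor; apply: mulr_ge0.
- by rewrite mulrCA; constructor.
- by rewrite mulrCA; constructor.
- by rewrite mulrDr; constructor.
Qed.

Lemma gamma_posM m n p q :
  gamma_pos m p -> gamma_pos n q -> gamma_pos (m + n) (p * q).
Proof.
move=> hp hq; elim: hp => {m p} [m|c c0|m p _ IH|m p _ IH|m p p' _ IHp _ IHq].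
- by rewrite mul0r; constructor.
- exact: gamma_posZ.
- by rewrite -mulrA; constructor.
- by rewrite -mulrA; constructor.
- by rewrite mulrDl; constructor.
Qed.

Lemma gamma_posMn n k p : gamma_pos n p -> gamma_pos n (k%:R * p).
Proof. by rewrite -polyC_natr; apply: gamma_posZ; apply: ler0n. Qed.

Lemma gamma_pos_sum n (I : Type) (r : seq I) (P : pred I) (f : I -> {poly R}) :
  (forall i, P i -> gamma_pos n (f i)) -> gamma_pos n (\sum_(i <- r | P i) f i).
Proof.
by move=> hf; elim/big_ind: _ => //; [constructor | move=> *; constructor].
Qed.

Lemma gamma_pos_conv a b (f g : nat -> {poly R}) n :
  (forall k, (k <= n)%N -> gamma_pos (k + a) (f k)) ->
  (forall k, (k <= n)%N -> gamma_pos (k + b) (g k)) ->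
  gamma_pos (n + a + b) (conv f g n).
Proof.
move=> hf hg; apply: gamma_pos_sum => -[k /= le_kn] _.
rewrite -mulrA; apply: gamma_posMn.
have -> : (n + a + b = k + a + (n - k + b))%N by lia.
by apply: gamma_posM; [apply: hf | apply: hg]; lia.
Qed.

Lemma gamma_pos_symm n p : gamma_pos n p -> symm_deg n p.
Proof.
move=> hp y y0; elim: hp => {n p} [n|c _|n p _ IH|n p _ IH|n p q _ IHp _ IHq].
- by rewrite !horner0 mulr0.
- by rewrite !hornerE.
- by rewrite !(hornerM, hornerX) IH !exprS; field.
- by rewrite !(hornerM, hornerD, hornerX, hornerC) IH !exprS; field.
- by rewrite !hornerE IHp IHq mulrDr.
Qed.

(** The last clause compares i with every j up to its mirror image n - i, not only up to the middle.
    In this form it survives multiplication by 1 + 'X, which moves the centre by one half. *)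
Definition symm_unimodal n p :=
  [/\ forall i, 0 <= p`_i, forall i, (i <= n)%N -> p`_i = p`_(n - i),
      forall i, (n < i)%N -> p`_i = 0 &
      forall i j, (i <= j)%N -> (i + j <= n)%N -> p`_i <= p`_j].

Lemma gamma_pos_symm_unimodal n p : gamma_pos n p -> symm_unimodal n p.
Proof.
elim=> {n p} [n|c c0|n p _ [p0 ps pd pm]|n p _ [p0 ps pd pm]
  |n p q _ [p0 ps pd pm] _ [q0 qs qd qm]].
- by split=> [i|i _|i _|i j _ _]; rewrite ?coef0.
- split=> [i|i|i|i j le_ij le0].
  + by rewrite coefC; case: ifP.
  + by rewrite leqn0 => /eqP ->.
  + by rewrite coefC; case: i.
  + by have -> : i = j by lia.
- split=> [i|i le_in|i lt_ni|i j le_ij le_n].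
  + by rewrite coefXM; case: ifP.
  + rewrite !coefXM; case: eqP => [->|/eqP i0]; first by rewrite subn0 /= pd.
    case: eqP => [e|/eqP n0]; first by apply: pd; lia.
    have -> : ((n.+2 - i).-1 = n - i.-1)%N by lia.
    by apply: ps; lia.
  + by rewrite coefXM; case: eqP => // /eqP i0; apply: pd; lia.
  + rewrite !coefXM; case: eqP => [_|/eqP i0]; first by case: ifP.
    by case: eqP => [|/eqP j0]; [lia | apply: pm; lia].
- have cE i : ((1 + 'X) * p)`_i = p`_i + (if i is i'.+1 then p`_i' else 0).
    by rewrite mulrDl mul1r coefD coefXM; case: i.
  split=> [i|i le_in|i lt_ni|i j le_ij le_n]; rewrite !cE.
  + by apply: addr_ge0 => //; case: i.
  + case: i le_in => [_|i le_in].
      by rewrite subn0 addr0 (pd n.+1) // add0r ps // subn0.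
    rewrite subSS; move: le_in; rewrite ltnS leq_eqVlt => /predU1P[->|lt_in]; last first.
      rewrite addrC ps 1?ltnW // (ps i.+1) //; congr (_ + _).
      by have -> : (n - i = (n - i.+1).+1)%N by lia.
    by rewrite subnn addr0 (pd n.+1) // add0r ps // subnn.
  + case: i lt_ni => [//|i] lt_ni; rewrite !pd ?addr0 //; lia.
  + case: (ltngtP i j) le_ij => // [lt_ij|->] _ //.
    case: j lt_ij le_n => [//|j] lt_ij le_n.
    (* The terms are matched crosswise, the smaller index on the left with the larger on the right;
       matching the two larger indices could exceed the mirror bound. *)
    rewrite addrC; case: i lt_ij le_n => [|i] lt_ij le_n.
      rewrite add0r -[leLHS]add0r; apply: lerD => //; apply: pm; lia.
    by apply: lerD; apply: pm; lia.
- split=> [i|i le_in|i lt_ni|i j le_ij le_n]; rewrite !coefD.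
  + exact: addr_ge0.
  + by rewrite ps // qs.
  + by rewrite pd // qd // addr0.
  + by apply: lerD; [apply: pm | apply: qm].
Qed.

Lemma symm_unimodal_unimodal n p : symm_unimodal n p -> unimodal_coefs p.
Proof.
case=> p0 ps pd pm; exists n./2; split=> i j /andP[le1 le2]; first by apply: pm; lia.
case: (ltngtP i j) le2 => // [lt_ij|->] _ //.
case: (leqP j n) => [le_jn|/pd -> //].
by rewrite (ps j) // (ps i); [apply: pm|]; lia.
Qed.

Lemma gamma_pos_eulerian n : gamma_pos n.+1 (eulerian 'X n : {poly R}).
Proof.
elim/ltn_ind: n => -[_|n IHn]; first by constructor.
have hE k : (k <= n)%N -> gamma_pos (k + 1) (eulerian 'X k : {poly R}).
  by rewrite addn1; apply: IHn.
rewrite eulerianS; apply: gamma_posD; first apply: gamma_posD.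
- case: n {IHn hE} => [|n] /=; last by constructor.
  rewrite -[X in gamma_pos _ X]mulr1; apply: gamma_posX.
  by rewrite -polyC1; constructor; apply: ler01.
- by constructor; apply: IHn.
- have := gamma_pos_conv hE hE; by rewrite -addnA addn2.
Qed.

Lemma gamma_pos_local_h n : gamma_pos n (local_h 'X n : {poly R}).
Proof.
elim/ltn_ind: n => -[_|n IHn].
  by rewrite /local_h /course /= -polyC1; constructor; apply: ler01.
rewrite -[local_h _ _]/(shift (local_h 'X) n) shift_local_h.
suff: gamma_pos (n + 1 + 0)
    (conv (ssub (conv (cst 2) (dilate (eulerian 'X))) (eulerian 'X)) (local_h 'X) n
      : {poly R}).
  by rewrite addn0 addn1.
apply: gamma_pos_conv => k le_kn; last by rewrite addn0; apply: IHn.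
rewrite /ssub conv_cst /dilate mulrA -exprS addn1.
have -> : 2 ^+ k.+1 * eulerian 'X k - eulerian 'X k =
    (2 ^ k.+1 - 1)%:R * eulerian 'X k :> {poly R}.
  by rewrite natrB ?expn_gt0 // natrX mulrBl mul1r.
by apply: gamma_posMn; apply: gamma_pos_eulerian.
Qed.

Lemma gamma_pos_eulerian_local_h n :
  gamma_pos n.+1 (conv (eulerian 'X) (local_h 'X) n : {poly R}).
Proof.
suff: gamma_pos (n + 1 + 0) (conv (eulerian 'X) (local_h 'X) n : {poly R}).
  by rewrite addn0 addn1.
apply: gamma_pos_conv => k _; rewrite ?addn1 ?addn0.
  exact: gamma_pos_eulerian.
exact: gamma_pos_local_h.
Qed.

(** The two symmetries give p(y) = y p(y) for y != 0, so p vanishes at 2, 3, 4, ..., more points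
    than its degree allows. *)
Lemma symm_deg_eq0 n p : symm_deg n p -> symm_deg n.+1 p -> p = 0.
Proof.
move=> s1 s2; apply/eqP; case: (boolP (p == 0)) => // p0.
have root_p y : y != 0 -> y != 1 -> root p y.
  move=> y0 y1; rewrite /root (s1 y) // mulf_eq0 expf_eq0 (negPf y0) andbF /=.
  have /eqP := s2 y y0; rewrite (s1 y) // exprS -mulrA -subr_eq0.
  rewrite -[X in X - _]mul1r -mulrBl !mulf_eq0 expf_eq0 (negPf y0) andbF /=.
  by rewrite subr_eq0 eq_sym (negPf y1).
pose rs := [seq k.+2%:R : R | k <- iota 0 (size p)].
have := @max_poly_roots _ p rs p0; rewrite size_map size_iota ltnn; apply.
  apply/allP => _ /mapP[k _ ->]; apply: root_p; first by rewrite pnatr_eq0.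
  by rewrite pnatr_eq1.
by rewrite map_inj_uniq ?iota_uniq // => i j /eqP; rewrite eqr_nat => /eqP [].
Qed.

End GammaPositive.

(** * Derangements and excedances *)

Section SubsetSums.
Variables (T : finType) (A : pzSemiRingType).

Lemma sum_subset_card (V : {set T}) (g : nat -> A) :
  \sum_(U : {set T} | U \subset V) g #|U| = \sum_(k < #|V|.+1) 'C(#|V|, k)%:R * g k.
Proof.
rewrite (partition_big (fun U : {set T} => inord #|U| : 'I_#|V|.+1) predT) //=.
apply: eq_bigr => k _.
rewrite (eq_bigl (fun U : {set T} =>
    U \in [set B : {set T} | B \subset V & #|B| == k])).
  rewrite (eq_bigr (fun=> g k)); last by move=> U; rewrite inE => /andP[_ /eqP->].
  by rewrite sumr_const cards_draws mulr_natl.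
move=> U; rewrite inE; case: (boolP (U \subset V)) => //= sUV.
by rewrite -val_eqE /= inordK // ltnS subset_leq_card.
Qed.

(** Each nonempty set is split into its top and the rest. A top is required only of sets satisfying
    [Q], which covers chains in a partial order as well as sets of integers. *)
Lemma sum_over_top (le : rel T) (Q : pred {set T}) (S : {set T})
    (g : {set T} -> A) :
  antisymmetric le ->
  (forall c, Q c -> c != set0 -> exists2 p, p \in c & {in c, forall q, le q p}) ->
  (forall p, le p p) ->
  \sum_(c : {set T} | [&& c \subset S, Q c & c != set0]) g c =
  \sum_(p in S)
    \sum_(c : {set T} | (c \subset [set q in S | (q != p) && le q p]) && Q (p |: c))
      g (p |: c).
Proof.
move=> anti_le topP refl_le.
pose top (c : {set T}) p := (p \in c) && [forall q in c, le q p].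
transitivity (\sum_(c : {set T} | [&& c \subset S, Q c & c != set0])
   \sum_(p | top c p) g c).
  apply: eq_bigr => c /and3P[_ Qc c0]; have [p pc leq_p] := topP c Qc c0.
  rewrite (big_pred1 p) // => q; apply/andP/eqP => [[qc /forall_inP leq_q]|->].
    by apply: anti_le; rewrite leq_p // leq_q.
  by split=> //; apply/forall_inP.
rewrite (exchange_big_dep (mem S)) /=; last first.
  by move=> c p /and3P[/subsetP sc _ _] /andP[/sc].
apply: eq_bigr => p pS.
rewrite (reindex_onto (fun c => p |: c) (fun c => c :\ p)) /=; last first.
  by move=> c /andP[_ /andP[pc _]]; rewrite setD1K.
apply: eq_bigl => c; rewrite /top setU11 /=.
have -> : (p |: c != set0) by apply/set0Pn; exists p; rewrite setU11.
have -> : ((p |: c) :\ p == c) = (p \notin c).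
  by apply/eqP/idP => [<-|/setU1K ->//]; rewrite !inE eqxx.
rewrite andbT subUset sub1set pS /=.
rewrite [RHS]andbC -!andbA [LHS]andbCA; congr (_ && _).
apply/and3P/subsetP => [[/subsetP sc /forall_inP lec pc] q qc|sc].
  by rewrite inE sc // lec ?inE ?qc ?orbT // andbT; apply: contraNneq pc => <-.
split; last by apply/negP => /sc; rewrite !inE eqxx andbF.
  by apply/subsetP => q /sc; rewrite inE => /andP[].
apply/forall_inP => q; rewrite !inE => /predU1P[->//|/sc].
by rewrite inE => /and3P[].
Qed.

Lemma sum_over_max (key : T -> int) (Q : pred {set T}) (S : {set T})
    (g : {set T} -> A) : injective key ->
  \sum_(c : {set T} | [&& c \subset S, Q c & c != set0]) g c =
  \sum_(p in S)
    \sum_(c : {set T} | (c \subset [set q in S | key q < key p]) && Q (p |: c))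
      g (p |: c).
Proof.
move=> inj_key; rewrite (@sum_over_top (fun q p => key q <= key p)) //.
- apply: eq_bigr => p pS; apply: eq_bigl => c.
  by congr (_ && _); apply: eq_subset_r => q; rewrite !inE lt_neqAle (inj_eq inj_key).
- by move=> p q /le_anti/inj_key.
- move=> c _ /set0Pn[q0 q0c]; case: (@arg_maxP _ _ _ q0 (mem c) key q0c) => p pc maxp.
  by exists p.
Qed.

End SubsetSums.

Lemma sum_subset_conv (T : finType) (A : comNzRingType) (V : {set T})
    (f g : nat -> A) :
  \sum_(U : {set T} | U \subset V) f #|U| * g (#|V| - #|U|)%N = conv f g #|V|.
Proof.
rewrite (sum_subset_card V (fun k => f k * g (#|V| - k)%N)).
by apply: eq_bigr => k _; rewrite mulrA.
Qed.

Section Derangements.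
Variables (T : finType) (key : T -> int) (A : comNzRingType) (x : A).
Hypothesis inj_key : injective key.
Implicit Types (V U : {set T}) (s : {perm T}).
Let u := 1 - x.

Definition excedances s := #|[set i | key i < key (s i)]|.
Definition perm_supp s := [set i | s i != i].

Definition exc_supp V : A := \sum_(s | perm_supp s == V) x ^+ excedances s.

(* Read along the cycle through m, such a permutation is a path starting at a;
   m will be the largest element, so that the arc m -> a is never an excedance. *)
Definition exc_supp_at V a m : A :=
  \sum_(s | (perm_supp s == a |: (m |: V)) && (s m == a)) x ^+ excedances s.

Lemma perm_supp_img s i : (s i \in perm_supp s) = (i \in perm_supp s).
Proof. by rewrite !inE (inj_eq perm_inj). Qed.

Lemma exc_supp_set0 : exc_supp set0 = 1.
Proof.
rewrite /exc_supp (big_pred1 1%g) => [|s].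
  rewrite /excedances (_ : [set _ | _] = set0) ?cards0 //.
  by apply/setP => i; rewrite !inE perm1 ltxx.
apply/eqP/eqP => [s0|->]; last by apply/setP => i; rewrite !inE perm1 eqxx.
apply/permP => i; move/setP/(_ i): s0; rewrite !inE perm1.
by move/negbFE/eqP.
Qed.

Lemma exc_supp_split V m : m \notin V ->
  exc_supp (m |: V) = \sum_(c in V) exc_supp_at (V :\ c) c m.
Proof.
move=> mV; rewrite /exc_supp (partition_big (fun s => s m) (mem V)) /=.
  apply: eq_bigr => c cV; rewrite /exc_supp_at; apply: eq_bigl => s.
  by rewrite setUCA setD1K.
move=> s /eqP supp_s; have m_s: m \in perm_supp s by rewrite supp_s setU11.
have := m_s; rewrite -perm_supp_img supp_s !inE => /predU1P[sm|//].
by rewrite inE sm eqxx in m_s.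
Qed.

(* Multiplying by the transposition (a c) removes a from its cycle
   m -> a -> c, leaving m -> c. *)
Lemma exc_bypass V a m c :
  a \notin m |: V -> m \notin V -> c \in m |: V ->
  key a < key m -> key c <= key m ->
  \sum_(s | (perm_supp s == a |: (m |: V)) && (s m == a) && (s a == c))
     x ^+ excedances s
  = x ^+ (key a < key c)%R *
    \sum_(s | (perm_supp s == if c == m then V else m |: V) && (s m == c))
       x ^+ excedances s.
Proof.
move=> aV mV cV lt_am le_cm.
have neq_am : a != m by apply: contraNneq aV => ->; rewrite setU11.
have neq_ca : c != a by apply: contraNneq aV => <-.
rewrite (reindex_inj (mulIg (tperm a c))) big_distrr /=.
have moved s i : s m = c -> s a = a -> i != m -> i != a ->
    (s * tperm a c)%g i = s i.
  move=> sm sa im ia; rewrite permM tpermD //.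
    by rewrite -{1}sa (inj_eq perm_inj) eq_sym.
  by rewrite -sm (inj_eq perm_inj) eq_sym.
have atm s : s m = c -> (s * tperm a c)%g m = a by move=> sm; rewrite permM sm tpermR.
have ata s : s a = a -> (s * tperm a c)%g a = c by move=> sa; rewrite permM sa tpermL.
apply: eq_big => s; last first.
  move=> /andP[/andP[_ /eqP sm] /eqP sa].
  have {}sm : s m = c.
    by apply: (@perm_inj _ (tperm a c)); rewrite tpermR -[RHS]sm permM.
  have {}sa : s a = a.
    by apply: (@perm_inj _ (tperm a c)); rewrite tpermL -[RHS]sa permM.
  rewrite -exprD; congr (x ^+ _).
  (* The fixed point [a] contributes nothing after the bypass, and the arc out of [m] is an
     excedance neither before nor after; only a -> c accounts for the extra factor. *)
  rewrite /excedances (cardsD1 a) inE ata //; congr (_ + _)%N.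
  apply: eq_card => i; rewrite !inE.
  case: (eqVneq i a) => [->|ia] /=; first by rewrite sa ltxx.
  case: (eqVneq i m) => [->|im]; last by rewrite moved.
  by rewrite atm // sm !ltNge (ltW lt_am) le_cm.
apply/andP/andP => [[/andP[/eqP supp_s /eqP sm] /eqP sa]|[/eqP supp_s /eqP sm]].
  have {}sm : s m = c.
    by apply: (@perm_inj _ (tperm a c)); rewrite tpermR -[RHS]sm permM.
  have {}sa : s a = a.
    by apply: (@perm_inj _ (tperm a c)); rewrite tpermL -[RHS]sa permM.
  split; last exact/eqP.
  apply/eqP/setP => i; rewrite inE.
  case: (eqVneq i a) => [->|ia].
    rewrite sa eqxx; apply/esym/negbTE; case: ifP => // _.
    by apply: contra aV => aV; rewrite inE aV orbT.
  case: (eqVneq i m) => [->|im].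
    by rewrite sm; case: ifP => _; rewrite ?setU11 // (negPf mV).
  move/setP/(_ i): supp_s; rewrite !inE moved // (negPf ia) (negPf im) /= => ->.
  by case: ifP => //; rewrite !inE (negPf im).
have sa : s a = a.
  apply/eqP; apply: contraNT aV => sa.
  have: a \in perm_supp s by rewrite inE.
  by rewrite supp_s; case: ifP => // _ aV; rewrite inE aV orbT.
rewrite atm // ata // !eqxx; split=> //; rewrite andbT.
apply/eqP/setP => i; rewrite !inE.
case: (eqVneq i a) => [->|ia]; first by rewrite ata.
case: (eqVneq i m) => [->|im]; first by rewrite atm.
rewrite moved //=.
move/setP/(_ i): supp_s; rewrite inE => ->.
by case: ifP => //; rewrite !inE (negPf im).
Qed.

(** The cases are the successors of [a]. If it is [m], the arc is an excedance and the bypass leaves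
    [m] fixed; otherwise the path continues from c in [V]. *)
Lemma exc_supp_at_rec V a m :
  a \notin m |: V -> m \notin V -> key a < key m ->
  {in V, forall c, key c < key m} ->
  exc_supp_at V a m
  = x * exc_supp V + \sum_(c in V) x ^+ (key a < key c)%R * exc_supp_at (V :\ c) c m.
Proof.
move=> aV mV lt_am maxm; rewrite /exc_supp_at.
rewrite (partition_big (fun s => s a) (mem (m |: V))) /=; last first.
  move=> s /andP[/eqP supp_s /eqP sm].
  have sa_s: a \in perm_supp s by rewrite supp_s setU11.
  have := sa_s; rewrite -perm_supp_img supp_s in_setU1 => /predU1P[sa|//].
  by rewrite inE sa eqxx in sa_s.
rewrite big_setU1 //=; congr (_ + _).
  rewrite exc_bypass ?setU11 // lt_am eqxx expr1; congr (_ * _).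
  apply: eq_bigl => s; case: eqP => //= supp_s.
  by apply/negPn; have := mV; rewrite -supp_s inE.
apply: eq_bigr => c cV.
have neq_cm : c != m by apply: contraNneq mV => <-.
rewrite exc_bypass //; [|by rewrite inE cV orbT|by apply/ltW/maxm].
rewrite (negPf neq_cm); congr (_ * _); apply: eq_bigl => s.
by rewrite setUCA setD1K.
Qed.

Let ext V m := exc_supp V + exc_supp (m |: V).

(* The elements visited after a form a decreasing run, determined by its set U. *)
Lemma exc_supp_at_run V a m :
  a \notin m |: V -> m \notin V -> key a < key m ->
  {in V, forall c, key c < key m} ->
  exc_supp_at V a m =
  \sum_(U : {set T} | U \subset [set c in V | key c < key a])
     x * u ^+ #|U| * ext (V :\: U) m.
Proof.
have [n] := ubnP #|V|; elim: n V a => // n IHn V a /ltnSE leVn aV mV lt_am maxm.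
rewrite exc_supp_at_rec //.
(* With x^[a < c] = x + u [c < a], the terms in x reassemble into all permutations supported on
   [m |: V], and only steps down from [a] are followed further. *)
transitivity (x * ext V m + u *
    \sum_(c in V | key c < key a) exc_supp_at (V :\ c) c m).
  rewrite /ext exc_supp_split // mulrDr -addrA; congr (_ + _).
  rewrite !big_distrr big_mkcondr -big_split /=; apply: eq_bigr => c cV.
  have neq_ac : key a != key c.
    by rewrite (inj_eq inj_key); apply: contraNneq aV => ->; rewrite inE cV orbT.
  by case: (ltgtP (key a) (key c)) neq_ac => //= _ _; rewrite /u; ring.
rewrite [RHS](bigD1 set0) ?sub0set //= cards0 mulr1 setD0; congr (_ + _).
rewrite (eq_bigl (fun U : {set T} =>
  [&& U \subset [set c in V | key c < key a], predT U & U != set0])) //.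
rewrite (sum_over_max _ _ _ inj_key) big_distrr /=.
rewrite [RHS](eq_bigl (fun c => (c \in V) && (key c < key a))); last first.
  by move=> c; rewrite inE.
apply: eq_bigr => c /andP[cV lt_ca].
rewrite IHn.
- rewrite big_distrr /=; apply: eq_big => U.
    rewrite andbT; apply: eq_subset_r => q; rewrite !inE.
    case: (ltP (key q) (key c)) => [lt_qc|_]; rewrite ?andbF //.
    rewrite (lt_trans lt_qc lt_ca) !andbT; case: (q \in V); rewrite ?andbF // andbT.
    by apply: contraTneq lt_qc => ->; rewrite ltxx.
  move=> sU; have cU : c \notin U.
    by apply/negP => /(subsetP sU); rewrite !inE eqxx.
  rewrite cardsU1 cU exprS; have -> : V :\ c :\: U = V :\: (c |: U).
    by rewrite setDDl.
  by ring.
- by move: leVn; rewrite (cardsD1 c) cV.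
- rewrite !inE eqxx /= orbF; apply: contraNneq mV => <-; exact: cV.
- by apply: contra mV; rewrite inE => /andP[].
- exact: maxm.
- by move=> q; rewrite inE => /andP[_]; apply: maxm.
Qed.

(** The image of [m] is the largest element of the decreasing run U after it, so U ranges over all
    nonempty subsets; U = [set0] may be added because [run] vanishes at 0. *)
Lemma exc_supp_run V m : m \notin V -> {in V, forall c, key c < key m} ->
  exc_supp (m |: V) =
  \sum_(U : {set T} | U \subset V)
     run x 1 #|U| * (exc_supp (V :\: U) + exc_supp (m |: (V :\: U))).
Proof.
move=> mV maxm; rewrite exc_supp_split //.
rewrite [RHS](bigD1 set0) ?sub0set //= cards0 mul0r add0r.
rewrite (eq_bigl (fun U : {set T} => [&& U \subset V, predT U & U != set0])) //.
rewrite (sum_over_max _ _ _ inj_key) /=; apply: eq_bigr => c cV.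
rewrite exc_supp_at_run.
- apply: eq_big => U.
    rewrite andbT; apply: eq_subset_r => q; rewrite !inE.
    case: (ltP (key q) (key c)) => [lt_qc|_]; rewrite ?andbF // !andbT.
    by case: eqVneq lt_qc => [->|]; rewrite ?ltxx.
  move=> sU; have cU : c \notin U.
    by apply/negP => /(subsetP sU); rewrite !inE eqxx.
  by rewrite cardsU1 cU /= expr1n mul1r setDDl.
- rewrite !inE eqxx /= orbF; apply: contraNneq mV => <-; exact: cV.
- by apply: contra mV; rewrite inE => /andP[].
- exact: maxm.
- by move=> q; rewrite inE => /andP[_]; apply: maxm.
Qed.

End Derangements.

(** The result does not depend on the order given by [key], so it applies to every choice of
    signs. *)
Lemma exc_supp_derange (T : finType) (key : T -> int) (A : idomainType) (x : A)
    (V : {set T}) : injective key -> 1 - x != 0 ->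
  exc_supp key x V = derange x #|V|.
Proof.
move=> inj_key x1; have [n] := ubnP #|V|; elim: n V => // n IHn V /ltnSE leVn.
case: (set_0Vmem V) leVn => [->|[q0 q0V]] leVn; first by rewrite cards0 exc_supp_set0.
case: (@arg_maxP _ _ _ q0 (mem V) key q0V) => m mV0 maxm.
have mV : m \in V by [].
have cardV : #|V| = #|V :\ m|.+1 by rewrite (cardsD1 m) mV.
rewrite -[V in LHS](setD1K mV) exc_supp_run ?setD11 //; last first.
  move=> c; rewrite !inE => /andP[cm cV].
  by rewrite lt_neqAle (inj_eq inj_key) cm; apply: maxm.
rewrite cardV -[derange _ _]/(shift (derange x) #|V :\ m|) (derange_run x1).
rewrite -sum_subset_conv.
apply: eq_bigr => U sU; case: (posnP #|U|) => [->|U0]; first by rewrite !mul0r.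
have cardD : #|V :\ m :\: U| = (#|V :\ m| - #|U|)%N by rewrite cardsD (setIidPr sU).
have mD : m \notin V :\ m :\: U by rewrite !inE eqxx andbF.
have leU := subset_leq_card sU.
by rewrite !IHn ?cardsU1 ?mD ?cardD //; lia.
Qed.

(** * Derangements of type B *)

Lemma selt_lt0 n (eps : {ffun 'I_n -> bool}) i : (selt eps i < 0) = eps i.
Proof. by rewrite /selt; case: (eps i); rewrite // oppr_lt0. Qed.

Lemma selt_gt0 n (eps : {ffun 'I_n -> bool}) i : (0 < selt eps i) = ~~ eps i.
Proof. by rewrite /selt; case: (eps i); rewrite // oppr_gt0. Qed.

Lemma selt_inj n (eps : {ffun 'I_n -> bool}) : injective (selt eps).
Proof.
move=> i j; rewrite /selt; case: (eps i); case: (eps j) => e; apply/val_inj => /=; lia.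
Qed.

(** The fixed letters of a derangement are negative, hence each is a B-excedance. *)
Lemma excB_supp n (eps : {ffun 'I_n -> bool}) (s : {perm 'I_n}) :
  derangementB eps s ->
  excB eps s = (n - #|perm_supp s| + excedances (selt eps) s)%N.
Proof.
move=> /forallP ders; rewrite /excB /excedances /wval.
have -> : (n - #|perm_supp s|)%N = #|~: perm_supp s|.
  by rewrite [RHS]cardsCs setCK card_ord.
rewrite -cardsUI [in RHS](_ : _ :&: _ = set0) ?cards0 ?addn0.
  apply: eq_card => i; rewrite !inE negbK (inj_eq (@selt_inj n eps)) orbC.
  have := ders i; rewrite /wval (inj_eq (@selt_inj n eps)) selt_gt0 selt_lt0.
  by case: eqP; case: (eps i).
apply/setP => i; rewrite !inE negbK; case: eqP => //= ->; exact: ltxx.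
Qed.

Lemma derangementB_supp n (eps : {ffun 'I_n -> bool}) (s : {perm 'I_n}) :
  derangementB eps s = ([set i | ~~ eps i] \subset perm_supp s).
Proof.
apply/forallP/subsetP => [ders i|ders i].
  rewrite !inE -selt_gt0 => i0; have /implyP/(_ i0) := ders i.
  by rewrite /wval (inj_eq (@selt_inj n eps)).
apply/implyP; rewrite selt_gt0 => i0; rewrite /wval (inj_eq (@selt_inj n eps)).
by have := ders i; rewrite !inE; apply.
Qed.

Lemma one_subX_neq0 (R : nzRingType) : 1 - 'X != 0 :> {poly R}.
Proof.
apply/eqP => /(congr1 (fun p : {poly R} => p.[0])) /eqP.
by rewrite hornerD hornerN hornerX horner0 hornerC subr0 oner_eq0.
Qed.

(** For a support K, letters outside K are negative fixed points, giving x^(n - #|K|), while the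
    signs inside K are free, giving 2^#|K|. *)
Lemma dB_derange (R : idomainType) n :
  dB R n = conv (dilate (derange 'X)) (geo 'X) n.
Proof.
have X1 := one_subX_neq0 R.
transitivity (\sum_(eps : {ffun 'I_n -> bool})
    \sum_(K : {set 'I_n} | [set i | ~~ eps i] \subset K)
      derange 'X #|K| * 'X^(n - #|K|) : {poly R}).
  apply: eq_bigr => eps _.
  rewrite (partition_big (@perm_supp _)
    (fun K : {set 'I_n} => [set i | ~~ eps i] \subset K)) /=; last first.
    by move=> s; rewrite derangementB_supp.
  apply: eq_bigr => K sK.
  rewrite -(exc_supp_derange K (@selt_inj n eps) X1) mulr_suml.
  apply: eq_big => s.
    by rewrite derangementB_supp; case: eqP => [->|]; rewrite ?sK ?andbF.
  by move=> /andP[ders /eqP <-]; rewrite excB_supp // addnC exprD.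
rewrite (reindex (fun M : {set 'I_n} => [ffun i => i \notin M])) /=; last first.
  exists (fun eps : {ffun 'I_n -> bool} => [set i | ~~ eps i]) => [M|eps] _.
    by apply/setP => i; rewrite inE ffunE negbK.
  by apply/ffunP => i; rewrite ffunE inE negbK.
rewrite (exchange_big_dep predT) //=.
rewrite -[in RHS](card_ord n) -cardsT -sum_subset_conv.
apply: eq_big => K; rewrite ?subsetT // => _.
rewrite /dilate /geo cardsT card_ord -mulrA [LHS](eq_bigl (mem (powerset K))); last first.
  by move=> M; rewrite !inE; apply: eq_subset => i; rewrite inE ffunE negbK.
by rewrite sumr_const card_powerset -[LHS]mulr_natl natrX.
Qed.

(** * Chains of intervals *)

Section IntervalChains.
Variable n : nat.
Implicit Types (p q : ivl n) (c S : {set ivl n}) (A B F U K : {set 'I_n}).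

Definition ivl_chain c := [forall I in c, forall J in c, ivl_le I J || ivl_le J I].
Definition ivl_dim p := #|p.2 :\: p.1|.
(** The lower end of [p] may be empty: [(set0, F)] serves as an artificial top above all intervals
    of [P] inside [F]. *)
Definition below p :=
  [set q : ivl n | [&& p.1 \subset q.1, q.1 \subset q.2, q.2 \subset p.2 & q != p]].

Lemma ivl_chainP c :
  reflect {in c &, forall I J, ivl_le I J || ivl_le J I} (ivl_chain c).
Proof.
apply: (iffP forall_inP) => [h I J Ic Jc|h I Ic].
  by have /forall_inP := h I Ic; apply.
by apply/forall_inP => J Jc; apply: h.
Qed.

Lemma ivl_le_refl p : ivl_le p p. Proof. by rewrite /ivl_le !subxx. Qed.

Lemma ivl_le_anti : antisymmetric (@ivl_le n).
Proof.
move=> [A B] [A' B'] /andP[/andP[/= s1 s2] /andP[/= s3 s4]].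
by congr (_, _); apply/eqP; rewrite eqEsubset ?s1 ?s2 ?s3 ?s4.
Qed.

Lemma ivl_chain_top c : ivl_chain c -> c != set0 ->
  exists2 p, p \in c & {in c, forall q, ivl_le q p}.
Proof.
move=> /ivl_chainP chc /set0Pn[q0 q0c].
(* This weight is strictly monotone even on pairs that are not intervals, unlike the size of the
   difference of the ends. *)
pose w p := (#|p.2| + #|~: p.1|)%N.
case: (@arg_maxnP _ q0 (mem c) w q0c) => p pc maxp; exists p => // q qc.
have /orP[//|/andP[s1 s2]] := chc q p qc pc.
have lew : (w q <= w p)%N by apply: maxp.
rewrite /w in lew.
have l1 : (#|~: p.1| <= #|~: q.1|)%N by rewrite subset_leq_card // setCS.
have e2 : q.2 = p.2.
  apply/esym/eqP; rewrite eqEcard s2 -(leq_add2r #|~: p.1|).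
  by apply: leq_trans lew; rewrite leq_add2l.
have e1 : ~: p.1 = ~: q.1.
  by apply/eqP; rewrite eqEcard setCS s1 /=; move: lew; rewrite e2 leq_add2l.
by rewrite /ivl_le e2 -(setCK q.1) -e1 setCK !subxx.
Qed.

Lemma ivl_chainU1 p c : {in c, forall q, ivl_le q p} ->
  ivl_chain (p |: c) = ivl_chain c.
Proof.
move=> lep; apply/ivl_chainP/ivl_chainP => chc I J.
  by move=> Ic Jc; apply: chc; rewrite !inE ?Ic ?Jc orbT.
rewrite !inE => /predU1P[->|Ic] /predU1P[->|Jc].
- by rewrite ivl_le_refl.
- by rewrite (lep J Jc) orbT.
- by rewrite (lep I Ic).
- exact: chc.
Qed.

Lemma ivl_dim_below p q : q \in below p -> (ivl_dim q < ivl_dim p)%N.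
Proof.
case: p q => [A B] [A' B']; rewrite inE /= => /and4P[s1 s12 s2 neq].
apply: proper_card; rewrite properE setDSS //=.
apply: contra neq => /subsetP sD.
have eA : A' = A.
  apply/eqP; rewrite eqEsubset s1 andbT; apply/subsetP => i iA'.
  have iB : i \in B by rewrite (subsetP s2) // (subsetP s12).
  by apply: contraT => iA; have := sD i; rewrite !inE iA iB iA' => /(_ isT).
have eB : B' = B.
  apply/eqP; rewrite eqEsubset s2 /=; apply/subsetP => i iB.
  case: (boolP (i \in A)) => [iA|iA]; first by rewrite (subsetP s12) // eA.
  by have := sD i; rewrite !inE iA iB => /(_ isT) /andP[].
by rewrite eA eB.
Qed.

Lemma below_down p q : p.1 \subset p.2 -> q \in below p ->
  [set r in below p | (r != q) && ivl_le r q] = below q.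
Proof.
move=> s12; rewrite inE => /and4P[s1 _ s2 neq].
apply/setP => r; rewrite !inE /ivl_le; apply/idP/idP.
  by move=> /andP[/and4P[_ -> _ _] /and3P[-> -> ->]].
move=> /and4P[t1 -> t2 ->]; rewrite t1 t2 (subset_trans s1 t1).
rewrite (subset_trans t2 s2) /= andbT.
apply: contraNneq neq => er; rewrite -er; apply/eqP/ivl_le_anti.
by rewrite er /ivl_le s1 s2 -er t1 t2.
Qed.

Lemma card_ivl_chain p c : ivl_chain c -> c \subset below p ->
  (#|c| <= ivl_dim p)%N.
Proof.
have [m] := ubnP (ivl_dim p); elim: m p c => // m IHm p c /ltnSE lem chc sc.
case: (eqVneq c set0) => [->|c0]; first by rewrite cards0.
have [q qc topq] := ivl_chain_top chc c0.
rewrite (cardsD1 q) qc add1n.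
have qp := subsetP sc q qc.
have ltd := ivl_dim_below qp; apply: leq_ltn_trans ltd; apply: IHm.
- exact: leq_trans (ivl_dim_below qp) lem.
- apply/ivl_chainP => I J; rewrite !inE => /andP[_ Ic] /andP[_ Jc].
  exact: (ivl_chainP _ chc).
apply/subsetP => r; rewrite !inE => /andP[rq rc]; rewrite rq andbT.
have := subsetP sc r rc; have := topq r rc.
by rewrite inE /ivl_le => /andP[-> ->] /and4P[_ -> _ _].
Qed.

(* U is the set of elements at which the subinterval differs from [A, B],
   and K the part of U added to A. *)
Lemma sum_ivl (R : nmodType) A B (G : ivl n -> R) : A \subset B ->
  \sum_(q : ivl n | [&& A \subset q.1, q.1 \subset q.2 & q.2 \subset B]) G q =
  \sum_(U : {set 'I_n} | U \subset B :\: A) \sum_(K : {set 'I_n} | K \subset U)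
    G (A :|: K, B :\: (U :\: K)).
Proof.
have subI (X Y : {set 'I_n}) : X \subset Y -> forall i, (i \in X) ==> (i \in Y).
  by move=> /subsetP s i; apply/implyP/s.
move=> sAB; rewrite pair_big_dep /=.
rewrite (reindex_onto (fun UK : {set 'I_n} * {set 'I_n} =>
    (A :|: UK.2, B :\: (UK.1 :\: UK.2)))
  (fun q => ((q.1 :\: A) :|: (B :\: q.2), q.1 :\: A))) /=; last first.
  move=> [A' B'] /= /and3P[/subI s1 /subI s2 /subI s3].
  congr (_, _); apply/setP => i; move: (s1 i) (s2 i) (s3 i); rewrite !inE;
    by case: (i \in A); case: (i \in A'); case: (i \in B); case: (i \in B').
apply: eq_bigl => -[U K] /=; apply/idP/idP.
  move=> /andP[/and3P[_ /subI s2 _]] /eqP[eU eK].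
  apply/andP; split; apply/subsetP => i; apply/implyP; move: (s2 i) (subI _ _ sAB i).
    rewrite -eU -eK !inE.
    by case: (i \in A); case: (i \in U); case: (i \in K); case: (i \in B).
  move: (congr1 (fun X : {set _} => i \in X) eU)
    (congr1 (fun X : {set _} => i \in X) eK).
  rewrite !inE; case: (i \in A); case: (i \in U); case: (i \in K);
  by case: (i \in B).
move=> /andP[/subI s1 /subI s2]; rewrite subsetUl subsetDl andbT /=.
apply/andP; split.
  apply/subsetP => i; apply/implyP; move: (s1 i) (s2 i) (subI _ _ sAB i); rewrite !inE.
  by case: (i \in A); case: (i \in U); case: (i \in K); case: (i \in B).
apply/eqP; congr (_, _); apply/setP => i;
  move: (s1 i) (s2 i) (subI _ _ sAB i); rewrite !inE;
  by case: (i \in A); case: (i \in U); case: (i \in K); case: (i \in B).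
Qed.

Lemma ivl_dim_sub A B U K : A \subset B -> U \subset B :\: A -> K \subset U ->
  ivl_dim (A :|: K, B :\: (U :\: K)) = (#|B :\: A| - #|U|)%N.
Proof.
move=> sAB sU sK; rewrite /ivl_dim /=.
have -> : B :\: (U :\: K) :\: (A :|: K) = B :\: A :\: U.
  apply/setP => i; have := subsetP sK i; rewrite !inE.
  by case: (i \in A); case: (i \in U); case: (i \in K); case: (i \in B) => //= ->.
by rewrite cardsD (setIidPr sU).
Qed.

Section Counting.
Variables (R : idomainType) (x : R).
Hypothesis x1 : 1 - x != 0.
Let u := 1 - x.

Definition chain_sum S m : R :=
  \sum_(c : {set ivl n} | (c \subset S) && ivl_chain c) x ^+ #|c| * u ^+ (m - #|c|).

(** Removing the top p splits the exponent of u into m - dim p - 1 and the exponent for the chain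
    below p; the bounds on dimensions and chain lengths keep the truncated subtractions exact. *)
Lemma chain_sum_rec S m :
  {in S, forall p, [set r in S | (r != p) && ivl_le r p] = below p} ->
  {in S, forall p, (ivl_dim p < m)%N} ->
  chain_sum S m = u ^+ m +
    \sum_(p in S) x * u ^+ (m - ivl_dim p).-1 * chain_sum (below p) (ivl_dim p).
Proof.
move=> downS dimS; rewrite /chain_sum (bigD1 set0) /=; last first.
  by rewrite sub0set; apply/ivl_chainP => I J; rewrite inE.
rewrite cards0 subn0 mul1r; congr (_ + _).
rewrite (eq_bigl (fun c => [&& c \subset S, ivl_chain c & c != set0])); last first.
  by move=> c; rewrite andbA.
rewrite (sum_over_top _ _ ivl_le_anti ivl_chain_top ivl_le_refl).
apply: eq_bigr => p pS; rewrite downS // big_distrr /=.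
have lep c : c \subset below p -> {in c, forall q, ivl_le q p}.
  by move=> /subsetP sc q /sc; rewrite inE /ivl_le => /and4P[-> _ -> _].
apply: eq_big => c.
  by case: (boolP (c \subset below p)) => //= /lep/ivl_chainU1 ->.
move=> /andP[sc]; rewrite ivl_chainU1; last exact: lep.
move=> chc; have pc : p \notin c.
  by apply/negP => /(subsetP sc); rewrite inE eqxx !andbF.
rewrite cardsU1 pc add1n exprS -!mulrA; congr (_ * _); rewrite mulrCA; congr (_ * _).
rewrite -exprD; congr (u ^+ _).
have aux d k : (d < m -> k <= d -> m - k.+1 = (m - d).-1 + (d - k))%N by lia.
exact: aux (dimS p pS) (card_ivl_chain chc sc).
Qed.

(** The subintervals of [p] are the faces of a cube, so this is the h-polynomial of the barycentric
    subdivision of its boundary. The 2^#|U| subintervals sharing a set U of removed positions give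
    [run x 2]. *)
Lemma chain_sum_below p : p.1 \subset p.2 ->
  chain_sum (below p) (ivl_dim p) = eulerianB x (ivl_dim p).
Proof.
have [m] := ubnP (ivl_dim p); elim: m p => // m IHm p /ltnSE lem s12.
rewrite chain_sum_rec; last exact: (@ivl_dim_below p); last first.
  by move=> q; apply: below_down.
rewrite (eulerianB_run x1) [RHS]/sadd; congr (_ + _).
transitivity (\sum_(q : ivl n | [&& p.1 \subset q.1, q.1 \subset q.2 & q.2 \subset p.2])
    if q == p then 0 else x * u ^+ (ivl_dim p - ivl_dim q).-1 * eulerianB x (ivl_dim q)).
  rewrite big_mkcond [RHS]big_mkcond; apply: eq_bigr => q _.
  rewrite inE; case: (eqVneq q p) => [->|neq]; first by rewrite !andbF; case: ifP.
  rewrite andbT; case: ifP => // /and3P[s1 s2 s3].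
  have qp : q \in below p by rewrite inE s1 s2 s3.
  by rewrite IHm //; apply: leq_trans lem; apply: ivl_dim_below.
rewrite sum_ivl // -sum_subset_conv; apply: eq_bigr => U sU.
have leU := subset_leq_card sU.
case: (posnP #|U|) => [/cards0_eq U0|U0].
  rewrite U0 cards0 mul0r big1 // => K; rewrite subset0 => /eqP ->.
  by rewrite setU0 !setD0 -surjective_pairing eqxx.
rewrite (eq_bigr (fun=> x * u ^+ #|U|.-1 * eulerianB x (ivl_dim p - #|U|))).
  rewrite (eq_bigl (mem (powerset U))); last by move=> K; rewrite !inE.
  rewrite sumr_const card_powerset -[LHS]mulr_natl natrX.
  by case: #|U| U0 => // k _ /=; ring.
move=> K sK; rewrite ifN; last first.
  apply/eqP => e; move: (ivl_dim_sub s12 sU sK); rewrite e -/(ivl_dim p) /ivl_dim; lia.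
rewrite ivl_dim_sub //; congr (x * u ^+ _ * _); rewrite /ivl_dim; lia.
Qed.

Lemma chain_sum_restr F :
  chain_sum [set q | is_ivl q && (q.2 \subset F)] #|F| = conv (geo 1) (local_h x) #|F|.
Proof.
rewrite chain_sum_rec.
- rewrite (local_h_run x1) [RHS]/sadd; congr (_ + _).
  (* Pairs with empty lower end enter with weight zero, so that [sum_ivl] applies to all of
     [(set0, F)]. *)
  transitivity (\sum_(q : ivl n | [&& set0 \subset q.1, q.1 \subset q.2 & q.2 \subset F])
     if q.1 == set0 then 0 else
       x * u ^+ (#|F| - ivl_dim q).-1 * eulerianB x (ivl_dim q)).
    rewrite big_mkcond [RHS]big_mkcond; apply: eq_bigr => q _.
    rewrite inE sub0set /is_ivl /=; case: (eqVneq q.1 set0) => [_|q0] /=.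
      by case: ifP.
    by case: ifP => // /andP[s1 s2]; rewrite chain_sum_below.
  rewrite sum_ivl ?sub0set // setD0 -sum_subset_conv; apply: eq_bigr => U sU.
  have leU := subset_leq_card sU.
  rewrite (bigD1 set0) ?sub0set //= setU0 eqxx add0r.
  case: (posnP #|U|) => [/cards0_eq U0|U0].
    rewrite U0 cards0 /ssub subrr mul0r big1 // => K.
    by rewrite subset0 => /andP[/eqP ->]; rewrite eqxx.
  rewrite (eq_bigr (fun=> x * u ^+ #|U|.-1 * eulerianB x (#|F| - #|U|))).
    rewrite (eq_bigl (mem (powerset U :\ set0))); last first.
      by move=> K; rewrite !inE andbC.
    rewrite sumr_const -[LHS]mulr_natl.
    have -> : #|powerset U :\ set0| = (2 ^ #|U| - 1)%N.
      have := cardsD1 set0 (powerset U); rewrite inE sub0set card_powerset; lia.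
    rewrite natrB ?expn_gt0 // natrX /ssub.
    by case: #|U| U0 => // k _ /=; rewrite expr1n; ring.
  move=> K /andP[sK K0]; rewrite set0U (negPf K0).
  have := @ivl_dim_sub set0 F U K (sub0set _); rewrite setD0 set0U => -> //.
  by rewrite subKn.
- move=> p; rewrite inE => /andP[/andP[p0 s12] s2].
  apply/setP => r; rewrite !inE /is_ivl /ivl_le; apply/idP/idP.
    by move=> /andP[/andP[/andP[_ ->] _] /and3P[-> -> ->]].
  move=> /and4P[t1 -> t2 ->]; rewrite t1 t2 (subset_trans t2 s2) !andbT.
  by apply: contraNneq p0 => r0; move: t1; rewrite r0 subset0.
move=> p; rewrite inE => /andP[/andP[p0 s12] s2]; rewrite /ivl_dim cardsD (setIidPr s12).
have aux a b m : (0 < a -> a <= b -> b <= m -> b - a < m)%N by lia.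
rewrite -card_gt0 in p0.
exact: aux p0 (subset_leq_card s12) (subset_leq_card s2).
Qed.

End Counting.

End IntervalChains.

(** * The h-polynomials of the restrictions of K_n *)

Lemma below_chainU1 n (q : ivl n) (c : {set ivl n}) :
  c \subset below q -> ivl_chain c ->
  ivl_chain (q |: c) /\ #|q |: c| = #|c|.+1.
Proof.
move=> sc chc; split.
  rewrite ivl_chainU1 // => r /(subsetP sc).
  by rewrite inE /ivl_le => /and4P[-> _ -> _].
rewrite cardsU1 (_ : q \notin c) //.
by apply/negP => /(subsetP sc); rewrite inE eqxx !andbF.
Qed.

Lemma ex_maximal_chain_below n (p : ivl n) : p.1 \subset p.2 ->
  exists c : {set ivl n}, [/\ c \subset below p, ivl_chain c & #|c| = ivl_dim p].
Proof.
have [m] := ubnP (ivl_dim p); elim: m p => // m IHm p /ltnSE lem s12.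
case: (set_0Vmem (p.2 :\: p.1)) => [D0|[b bD]].
  exists set0; split; first exact: sub0set.
    by apply/ivl_chainP => I J; rewrite inE.
  by rewrite /ivl_dim D0 !cards0.
have := bD; rewrite inE => /andP[bA bB].
pose q : ivl n := (p.1, p.2 :\ b).
have q12 : q.1 \subset q.2 by rewrite subsetD1 s12.
have qp : q \in below p.
  rewrite inE subxx q12 subD1set /=; apply: contraTneq bB => <-.
  by rewrite /= !inE eqxx.
have dq : ivl_dim p = (ivl_dim q).+1.
  rewrite /ivl_dim (cardsD1 b) bD; congr _.+1; apply: eq_card => i.
  by rewrite !inE; do 2!case: (_ \in _); rewrite ?andbF.
have [|c [sc chc cardc]] := IHm q _ q12; first by rewrite -dq.
have [chqc cardqc] := below_chainU1 sc chc.
exists (q |: c); split=> //; last by rewrite cardqc cardc.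
rewrite subUset sub1set qp; apply/subsetP => r /(subsetP sc).
rewrite -(below_down s12 qp) inE; by case/andP.
Qed.

Definition ivl_in n (F : {set 'I_n}) := [set q | is_ivl q && (q.2 \subset F)].

Lemma ivl_in_below n (F : {set 'I_n}) : ivl_in F \subset below (set0, F).
Proof.
apply/subsetP => -[A B]; rewrite !inE /is_ivl sub0set /= => /andP[/andP[A0 ->] ->].
by apply: contra A0 => /eqP[->].
Qed.


Lemma KnRestrE n (F : {set 'I_n}) c :
  (c \in KnRestr F) = (c \subset ivl_in F) && ivl_chain c.
Proof.
rewrite inE /is_chain -/(ivl_chain c).
case: (boolP (ivl_chain c)) => chc; rewrite ?andbF ?andbT //.
rewrite /carrier; case: pickP => [p /andP[pc /forall_inP topp]|notop].
  apply/andP/subsetP => [[/forall_inP ivlc pF] q qc|sc].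
    rewrite inE ivlc //; have /andP[_ qp] := topp q qc.
    exact: subset_trans qp pF.
  split; first by apply/forall_inP => q /sc; rewrite inE => /andP[].
  by have := sc p pc; rewrite inE => /andP[].
(* The default carrier is reached by the empty chain only. *)
rewrite sub0set andbT.
case: (eqVneq c set0) => [->|c0].
  by rewrite sub0set; apply/forall_inP => q; rewrite inE.
have [p pc topp] := ivl_chain_top chc c0.
by have /negP[] := notop p; rewrite pc; apply/forall_inP.
Qed.

Lemma max_card_KnRestr n (F : {set 'I_n}) :
  (\max_(c in KnRestr F) #|c|)%N = #|F|.
Proof.
have dF : ivl_dim (set0, F) = #|F| by rewrite /ivl_dim setD0.
apply/eqP; rewrite eqn_leq; apply/andP; split.
  apply/bigmax_leqP => c; rewrite KnRestrE => /andP[sc chc].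
  by rewrite -dF card_ivl_chain // (subset_trans sc (ivl_in_below F)).
case: (set_0Vmem F) => [->|[a aF]]; first by rewrite cards0.
(* This interval has dimension #|F| - 1; together with a maximal chain below it, it forms a face of
   size #|F|. *)
pose q : ivl n := ([set a], F).
have q12 : q.1 \subset q.2 by rewrite sub1set.
have [c [sc chc cardc]] := ex_maximal_chain_below q12.
have [chqc cardqc] := below_chainU1 sc chc.
have -> : #|F| = #|q |: c|.
  by rewrite cardqc cardc /ivl_dim /= (cardsD1 a) aF.
apply: leq_bigmax_cond; rewrite KnRestrE chqc andbT subUset sub1set.
have a0 : [set a] != set0 by apply/set0Pn; exists a; rewrite inE.
rewrite inE /is_ivl a0 q12 subxx /=; apply/subsetP => -[A B] /(subsetP sc).
rewrite !inE /is_ivl /= => /and4P[sA -> -> _]; rewrite !andbT.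
by apply: contraNneq a0 => A0; move: sA; rewrite A0 subset0.
Qed.

Lemma hpoly_KnRestr (R : idomainType) n (F : {set 'I_n}) :
  hpoly R (KnRestr F) = conv (geo 1) (local_h 'X) #|F|.
Proof.
rewrite /hpoly max_card_KnRestr -(chain_sum_restr (one_subX_neq0 R)).
by apply: eq_bigl => c; rewrite KnRestrE.
Qed.

(** The alternating sum over subsets is multiplication by e^(-t), which undoes the factor e^t in the
    h-polynomials. *)
Lemma localh_KnE (R : idomainType) n : localh_Kn R n = local_h 'X n.
Proof.
have -> : local_h 'X = conv (conv (geo 1) (local_h 'X)) (geo (-1)) :> (nat -> {poly R}).
  by rewrite convC convA conv_geo addrC subrr geo0 conv1.
rewrite -[in RHS](card_ord n) -cardsT -sum_subset_conv cardsT card_ord.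
apply: eq_big => F; first by rewrite subsetT.
by move=> _; rewrite hpoly_KnRestr mulrC.
Qed.

(** * Words of signed permutations *)

(* Descents of the word [0 :: rev t]. *)
Fixpoint rdes (t : seq int) : nat :=
  if t is a :: t' then ((a < head 0 t')%R + rdes t')%N else 0.

Lemma rdes_rev (w : seq int) :
  rdes (rev w) =
  (\sum_(i < size w) (nth 0 ((0 : int) :: w) i.+1 < nth 0 ((0 : int) :: w) i)%R)%N.
Proof.
elim/last_ind: w => [|w z IHw]; first by rewrite big_ord0.
rewrite rev_rcons size_rcons big_ord_recr /= IHw addnC; congr (_ + _)%N.
  apply: eq_bigr => i _ /=; rewrite nth_rcons ltn_ord.
  congr (nat_of_bool (_ < _)); case: (nat_of_ord i) (ltn_ord i) => // j ltj.
  by rewrite /= nth_rcons (ltnW ltj).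
rewrite nth_rcons ltnn eqxx; congr (nat_of_bool (_ < _)).
case/lastP: w {IHw} => // w y; rewrite rev_rcons size_rcons /=.
by rewrite nth_rcons size_rcons leqnn nth_rcons ltnn eqxx.
Qed.

Section SignedWords.
Variable n : nat.
Local Notation letter := ('I_n * bool)%type.
Implicit Types (V U M : {set 'I_n}) (a b : letter) (X Y : {set letter}).

Definition lval a : int := if a.2 then - (a.1.+1 : int) else (a.1.+1 : int).

Lemma lval_inj : injective lval.
Proof.
move=> [i e] [j f]; rewrite /lval /=; case: e; case: f => e; try lia;
by congr (_, _); apply/val_inj => /=; lia.
Qed.

Lemma lval_gt0 a : (0 < lval a) = ~~ a.2.
Proof. by rewrite /lval; case: a.2; rewrite // oppr_gt0. Qed.

Lemma lval_lt0 a : (lval a < 0) = a.2.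
Proof. by rewrite /lval; case: a.2; rewrite // oppr_lt0. Qed.

Lemma perm_enum_cons i (s : seq 'I_n) V :
  perm_eq (i :: s) (enum V) = (i \in V) && perm_eq s (enum (V :\ i)).
Proof.
case: (boolP (i \in V)) => iV; last first.
  apply/negbTE/negP => /perm_mem/(_ i).
  by rewrite mem_enum (negPf iV) in_cons eqxx.
have e : perm_eq (enum V) (i :: enum (V :\ i)).
  apply: uniq_perm; rewrite /= ?enum_uniq ?mem_enum ?setD11 //.
  by move=> j; rewrite in_cons !mem_enum !inE; case: eqVneq => [->|].
by rewrite (permPr e) perm_cons.
Qed.

Section WordSums.
Variables (R : idomainType) (x : R).
Let u := 1 - x.

(* The tuples are reversed words: their first letter is the last of the word. *)
Definition word_sum (P : pred letter) k V : R :=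
  \sum_(t : k.-tuple letter | perm_eq (unzip1 t) (enum V) && all P (take 1 t))
    x ^+ rdes (map lval t).

Definition word_sum_at k V a : R :=
  \sum_(t : k.-tuple letter | perm_eq (unzip1 t) (enum (V :\ a.1)))
    x ^+ rdes (lval a :: map lval t).

Lemma sum_tuple_cons (T : finType) k (P : pred (seq T)) (F : seq T -> R) :
  \sum_(t : k.+1.-tuple T | P t) F t =
  \sum_a \sum_(t : k.-tuple T | P (a :: t)) F (a :: t).
Proof.
rewrite pair_big_dep (reindex (fun p : T * k.-tuple T => [tuple of p.1 :: p.2])) //=.
exists (fun t => (thead t, [tuple of behead t])) => [[a t]|t] _ /=.
  by congr (_, _); apply/val_inj.
by rewrite [RHS]tuple_eta.
Qed.

Lemma word_sum0 P : word_sum P 0 set0 = 1.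
Proof.
rewrite /word_sum (big_pred1 [tuple]) //= => t; rewrite tuple0.
by rewrite [RHS]eqxx enum_set0.
Qed.

Lemma word_sum_split P k V :
  word_sum P k.+1 V = \sum_(a | (a.1 \in V) && P a) word_sum_at k V a.
Proof.
rewrite /word_sum (sum_tuple_cons _
  (fun t => perm_eq (unzip1 t) (enum V) && all P (take 1 t))
  (fun t => x ^+ rdes (map lval t))) [RHS]big_mkcond.
apply: eq_bigr => a _; case: ifP => [/andP[aV Pa]|aVP].
  by apply: eq_bigl => t; rewrite /= perm_enum_cons aV Pa /= take0 andbT.
rewrite big1 // => t /=; rewrite perm_enum_cons take0 andbT -andbA andbCA.
by rewrite aVP andbF.
Qed.

Lemma word_sum_at0 V a : V :\ a.1 = set0 -> word_sum_at 0 V a = x ^+ (lval a < 0)%R.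
Proof.
move=> V0; rewrite /word_sum_at (big_pred1 [tuple]) /= ?addn0 // => t.
by rewrite tuple0 [RHS]eqxx V0 enum_set0.
Qed.

Lemma word_sum_atS k V a :
  word_sum_at k.+1 V a =
  \sum_(b | b.1 \in V :\ a.1) x ^+ (lval a < lval b)%R * word_sum_at k (V :\ a.1) b.
Proof.
rewrite /word_sum_at (sum_tuple_cons _
  (fun t => perm_eq (unzip1 t) (enum (V :\ a.1)))
  (fun t => x ^+ rdes (lval a :: map lval t))) [RHS]big_mkcond.
apply: eq_bigr => b _; case: ifP => bV.
  rewrite big_distrr /=; apply: eq_big => t; first by rewrite perm_enum_cons bV.
  by move=> _; rewrite -exprD.
by rewrite big1 // => t /=; rewrite perm_enum_cons bV.
Qed.

Definition words V : R := word_sum predT #|V| V.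
Definition words_at V a : R := word_sum_at #|V :\ a.1| V a.

Lemma words_split V : V != set0 ->
  words V = \sum_(a | a.1 \in V) words_at V a.
Proof.
rewrite -card_gt0 /words => V0; rewrite -(prednK V0) word_sum_split.
apply: eq_big => a; first by rewrite andbT.
by move=> /andP[aV _]; rewrite /words_at (cardsD1 a.1 V) aV.
Qed.

(** The factor x^[a < b] for the last two letters is expanded. In a one-letter word, [a] is compared
    with 0 instead, which gives the indicator term. *)
Lemma words_at_rec V a :
  words_at V a = x * words (V :\ a.1) +
    u * (((V :\ a.1 == set0) && (0 < lval a))%:R +
         \sum_(b | (b.1 \in V :\ a.1) && (lval b < lval a)) words_at (V :\ a.1) b).
Proof.
case: (eqVneq (V :\ a.1) set0) => [V0|V0].
  rewrite /words_at V0 cards0 word_sum_at0 // /words cards0 word_sum0 mulr1.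
  rewrite big1 => [|b]; last by rewrite inE.
  by rewrite addr0 lval_gt0 lval_lt0 /u; case: a.2 => /=; ring.
rewrite /= add0r [in x * _](words_split V0) /words_at.
have := V0; rewrite -card_gt0 => /prednK <-.
rewrite word_sum_atS !big_distrr /= big_mkcondr -big_split /=.
apply: eq_bigr => b bV; rewrite (cardsD1 b.1 (V :\ a.1)) bV /=.
have neq_ab : lval a != lval b.
  rewrite (inj_eq lval_inj); apply: contraTneq bV => <-; by rewrite setD11.
by case: (ltgtP (lval a) (lval b)) neq_ab => //= _ _; rewrite /u; ring.
Qed.

(** An increasing run is determined by its set of letters; no index may occur in it with both
    signs. *)
Definition consistent X :=
  [forall p in X, forall q in X, (p.1 == q.1) ==> (p == q)].

Lemma consistentP X :
  reflect {in X &, forall p q, p.1 = q.1 -> p = q} (consistent X).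
Proof.
apply: (iffP forall_inP) => [h p q pX qX e|h p pX].
  by have /forall_inP/(_ q qX) := h p pX; rewrite e eqxx => /eqP.
by apply/forall_inP => q qX; apply/implyP => /eqP e; apply/eqP/h.
Qed.

Definition letters_below V b := [set q : letter | (q.1 \in V) && (lval q < lval b)].

(* The second term is the word that is a single increasing positive run. *)
Definition run_weight V Y : R :=
  x * words (V :\: (fst @: Y)) +
  u * ((fst @: Y == V) && [forall q in Y, 0 < lval q])%:R.

Lemma consistentU1 V b X :
  (X \subset letters_below V b) && consistent (b |: X) =
  (X \subset letters_below (V :\ b.1) b) && consistent X.
Proof.
apply/andP/andP => [[/subsetP sX /consistentP cX]|[/subsetP sX /consistentP cX]].
  split; last first.
    by apply/consistentP => p q pX qX; apply: cX; rewrite inE ?pX ?qX orbT.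
  apply/subsetP => q qX; have := sX q qX; rewrite !inE => /andP[-> lt_qb].
  rewrite lt_qb !andbT; apply/eqP => e; move: lt_qb.
  have -> : q = b by apply: cX e; rewrite in_setU1 ?eqxx ?qX ?orbT.
  by rewrite ltxx.
have neq q : q \in X -> q.1 != b.1.
  by move=> /sX; rewrite !inE -andbA => /andP[].
split; first by apply/subsetP => q /sX; rewrite !inE -andbA => /and3P[_ -> ->].
apply/consistentP => p q; rewrite !inE => /predU1P[->|pX] /predU1P[->|qX] //.
- by move=> e; have := neq q qX; rewrite e eqxx.
- by move=> e; have := neq p pX; rewrite e eqxx.
- exact: cX.
Qed.

(** Iterating [words_at_rec] follows the last increasing run backwards from its largest letter [a];
    X collects its other letters. *)
Lemma words_at_run V a : a.1 \in V ->
  words_at V a =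
  \sum_(X : {set letter} | (X \subset letters_below (V :\ a.1) a) && consistent X)
    u ^+ #|X| * run_weight V (a |: X).
Proof.
have [m] := ubnP #|V|; elim: m V a => // m IHm V a /ltnSE lem aV.
rewrite words_at_rec [RHS](bigD1 set0) /=; last first.
  by rewrite sub0set; apply/consistentP => p q; rewrite inE.
rewrite cards0 mul1r setU0 mulrDr addrA; congr (_ + _).
  rewrite /run_weight imset_set1; congr (_ + _ * (_ && _)%:R).
    rewrite setD_eq0 subset1; case: eqVneq => //= _.
    by apply: contraTF aV => /eqP ->; rewrite inE.
  apply/idP/forall_inP => [a0 q|]; first by rewrite inE => /eqP->.
  by apply; rewrite inE.
rewrite (eq_bigl (fun X => [&& X \subset letters_below (V :\ a.1) a,
  consistent X & X != set0])); last by move=> X; rewrite andbA.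
rewrite (sum_over_max _ _ _ lval_inj) big_distrr /=.
apply: eq_big => b; first by rewrite [RHS]inE.
move=> /andP[bV lt_ba]; rewrite IHm //; last first.
  by move: lem; rewrite (cardsD1 a.1) aV.
rewrite big_distrr /=; apply: eq_big => X.
  rewrite -consistentU1; congr (_ && _); apply: eq_subset_r => q; rewrite !inE.
  by case: (ltP (lval q) (lval b)) => [/lt_trans/(_ lt_ba)->|]; rewrite ?andbT ?andbF.
move=> /andP[sX cX].
have bX : b \notin X by apply/negP => /(subsetP sX); rewrite !inE eqxx.
rewrite cardsU1 bX exprS -mulrA; congr (_ * (_ * _)).
have sY : fst @: (b |: X) \subset V :\ a.1.
  rewrite imsetU1 subUset sub1set bV; apply/subsetP => _ /imsetP[q /(subsetP sX) qX ->].
  by move: qX; rewrite !inE -!andbA => /and4P[_ -> -> _].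
rewrite /run_weight (imsetU1 _ a) -setDDl; congr (_ + _ * (_ && _)%:R).
  apply/eqP/eqP => [->|e]; first by rewrite setD1K.
  rewrite -e setU1K //; apply/negP => /(subsetP sY); by rewrite !inE eqxx.
apply/forall_inP/forall_inP => pos q; last by move=> qY; apply: pos; rewrite inE qY orbT.
rewrite in_setU1 => /predU1P[->|]; last exact: pos.
by apply: lt_trans lt_ba; apply: pos; rewrite setU11.
Qed.

Definition signed_set U M : {set letter} := [set q | (q.1 \in U) && (q.2 == (q.1 \in M))].

Lemma fst_signed_set U M : fst @: signed_set U M = U.
Proof.
apply/setP => i; apply/imsetP/idP => [[q] |iU]; first by rewrite inE => /andP[? _] ->.
by exists (i, i \in M); rewrite // inE iU eqxx.
Qed.

Lemma consistent_signed_set U M : consistent (signed_set U M).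
Proof.
apply/consistentP => -[i e] [j f]; rewrite !inE /= => /andP[_ /eqP->] /andP[_ /eqP->].
by move=> ->.
Qed.

Lemma card_consistent X : consistent X -> #|X| = #|fst @: X|.
Proof. by move=> /consistentP cX; rewrite card_in_imset. Qed.

Lemma sum_consistent V (G : {set letter} -> R) :
  \sum_(Y : {set letter} | (fst @: Y \subset V) && consistent Y) G Y =
  \sum_(U : {set 'I_n} | U \subset V)
    \sum_(M : {set 'I_n} | M \subset U) G (signed_set U M).
Proof.
rewrite pair_big_dep /=.
rewrite (reindex_onto (fun UM : {set 'I_n} * {set 'I_n} => signed_set UM.1 UM.2)
  (fun Y => (fst @: Y, [set i | (i, true) \in Y]))) /=; last first.
  move=> Y /andP[_ /consistentP cY]; apply/setP => -[i e]; rewrite !inE /=.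
  apply/andP/idP => [[/imsetP[[j f] jY /= ->]]|iY].
    case: (boolP ((j, true) \in Y)) => [jtY /eqP -> //|jtY /eqP ->].
    by case: f jY => // jY; rewrite jY in jtY.
  split; first by apply/imsetP; exists (i, e).
  apply/eqP; case: e iY => iY; first by rewrite iY.
  by apply/esym/negP => itY; have := cY _ _ iY itY erefl.
apply: eq_bigl => -[U M] /=; rewrite fst_signed_set consistent_signed_set andbT.
congr (_ && _); apply/eqP/idP => [[<-]|sMU].
  by apply/subsetP => i; rewrite !inE => /andP[].
congr (_, _); apply/setP => i; rewrite !inE /=.
by case: (boolP (i \in M)) => [/(subsetP sMU)->|]; rewrite ?andbF.
Qed.

(** The flag [true] leads to B_n and [false] to B^+_n, so both are treated at once. *)
Definition end_ok (all_ends : bool) a := all_ends || (0 < lval a).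

Lemma end_ok_signed_set f U M : U != set0 -> M \subset U ->
  [exists q in signed_set U M, end_ok f q] = f || (M != U).
Proof.
move=> /set0Pn[i0 iU] sMU; apply/exists_inP/idP => [[q]|].
  rewrite inE /end_ok lval_gt0 => /andP[qU /eqP ->]; case: f => //=.
  by apply: contraNneq => ->.
have signedU i : i \in U -> (i, i \in M) \in signed_set U M.
  by move=> iU'; rewrite inE iU' eqxx.
case: f => [_|/=]; first by exists (i0, i0 \in M); rewrite ?signedU.
rewrite eqEsubset sMU /= => /subsetPn[i iU' iM].
by exists (i, i \in M); rewrite ?signedU // /end_ok lval_gt0.
Qed.

Lemma card_end_ok f U :
  \sum_(M : {set 'I_n} | M \subset U) [exists q in signed_set U M, end_ok f q]%:R =
  (if #|U| == 0%N then 0 else 2 ^+ #|U| - (~~ f)%:R) :> R.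
Proof.
case: ifPn => [/eqP/cards0_eq ->|]; last rewrite cards_eq0 => U0.
  rewrite big1 // => M _; rewrite (_ : [exists q in _, _] = false) //.
  by apply/negbTE/exists_inP => -[q]; rewrite !inE.
rewrite (bigD1 U) //= end_ok_signed_set // eqxx orbF.
rewrite (eq_bigr (fun=> 1)) => [|M /andP[sM neq]]; last first.
  by rewrite end_ok_signed_set // neq orbT.
rewrite (eq_bigl (mem (powerset U :\ U))); last by move=> M; rewrite !inE andbC.
rewrite sumr_const.
have -> : #|powerset U :\ U| = (2 ^ #|U| - 1)%N.
  have := cardsD1 U (powerset U); rewrite inE subxx card_powerset; lia.
by rewrite natrB ?expn_gt0 // natrX; case: f; rewrite /=; ring.
Qed.

(** The last letter is the largest of its run, so it is positive exactly when some letter of the run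
    is; the admissible signs then depend on the run alone. *)
Lemma word_sum_run f V : V != set0 ->
  \sum_(a | (a.1 \in V) && end_ok f a) words_at V a =
  u ^+ #|V| + \sum_(U : {set 'I_n} | U \subset V)
    (run x 2 #|U| - (~~ f)%:R * run x 1 #|U|) * words (V :\: U).
Proof.
move=> V0.
pose g Y := [exists q in Y, end_ok f q]%:R * u ^+ #|Y|.-1 * run_weight V Y.
transitivity (\sum_(Y : {set letter} | (fst @: Y \subset V) && consistent Y) g Y).
  rewrite (bigD1 set0) /=; last first.
    by rewrite imset0 sub0set; apply/consistentP => p q; rewrite inE.
  rewrite [X in _ = X + _](_ : _ = 0) ?add0r; last first.
    rewrite /g (_ : [exists q in _, _] = false) ?mul0r //.
    by apply/negbTE/exists_inP => -[q]; rewrite inE.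
  rewrite [RHS](eq_bigl (fun Y => [&& Y \subset [set q : letter | q.1 \in V],
      consistent Y & Y != set0])); last first.
    move=> Y; rewrite -andbA; congr (_ && _).
    apply/subsetP/subsetP => sY => [q qY|_ /imsetP[q qY ->]].
      by rewrite inE; apply: sY; apply: imset_f.
    by have := sY q qY; rewrite inE.
  rewrite (sum_over_max _ _ _ lval_inj) big_mkcondr /=.
  apply: eq_big => a; first by rewrite inE.
  move=> aV; rewrite (words_at_run aV).
  have exP X : X \subset letters_below (V :\ a.1) a ->
      [exists q in a |: X, end_ok f q] = end_ok f a.
    move=> /subsetP sX; apply/exists_inP/idP => [[q]|okf]; last first.
      by exists a; rewrite ?setU11.
    rewrite in_setU1 /end_ok => /predU1P[->//|/sX].
    rewrite inE => /andP[_ lt_qa] /orP[->//|q0].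
    by rewrite (lt_trans q0 lt_qa) orbT.
  have predE X : (X \subset letters_below (V :\ a.1) a) && consistent X =
     (X \subset [set q in [set q : letter | q.1 \in V] | lval q < lval a])
       && consistent (a |: X).
    rewrite -consistentU1; congr (_ && _); apply: eq_subset_r => q; by rewrite !inE.
  case: ifPn => oka.
    apply: eq_big => X; first exact: predE.
    move=> /andP[sX cX]; rewrite /g exP // oka mul1r; congr (u ^+ _ * _).
    rewrite cardsU1 (_ : a \notin X) //; apply/negP => /(subsetP sX).
    by rewrite !inE eqxx.
  rewrite big1 // => X; rewrite -predE => /andP[sX cX].
  by rewrite /g exP // (negPf oka) !mul0r.
rewrite sum_consistent.
transitivity (\sum_(U : {set 'I_n} | U \subset V) (
   (\sum_(M : {set 'I_n} | M \subset U) [exists q in signed_set U M, end_ok f q]%:R)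
       * (u ^+ #|U|.-1 * x * words (V :\: U))
   + \sum_(M : {set 'I_n} | M \subset U) ((U == V) && (M == set0))%:R * u ^+ #|U|)).
  apply: eq_bigr => U sUV; rewrite big_distrl -big_split /=.
  apply: eq_bigr => M sMU; rewrite /g /run_weight fst_signed_set.
  rewrite (card_consistent (consistent_signed_set U M)) fst_signed_set.
  rewrite mulrDr -!mulrA; congr (_ + _).
  case: (eqVneq U V) => [eUV|] /=; last by rewrite !(mulr0, mul0r).
  rewrite eUV in sMU *.
  have -> : [forall q in signed_set V M, 0 < lval q] = (M == set0).
    apply/forall_inP/eqP => [pos|-> q].
      apply/setP => i; rewrite inE; apply/negP => iM.
      have := pos (i, true); rewrite inE /= (subsetP sMU) // iM lval_gt0.
      by move=> /(_ isT).
    by rewrite inE lval_gt0 => /andP[_ /eqP->]; rewrite inE.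
  rewrite end_ok_signed_set //.
  case: (eqVneq M set0) => [->|_]; last by rewrite !(mulr0, mul0r).
  by rewrite eq_sym V0 orbT mulr1 !mul1r -exprSr prednK ?card_gt0.
rewrite big_split /= addrC; congr (_ + _).
  rewrite (bigD1 V) //= (bigD1 set0) ?sub0set //= !eqxx mul1r.
  rewrite big1 => [|M /andP[_ /negPf->]]; last by rewrite andbF mul0r.
  rewrite addr0 big1 ?addr0 // => U /andP[_ /negPf->].
  by rewrite big1 // => M _; rewrite mul0r.
apply: eq_bigr => U sU; rewrite card_end_ok.
case: #|U| => [|k] /=; first by rewrite /run mulr0 subrr !mul0r.
by rewrite /run; case: f {g} => /=; rewrite ?expr1n; ring.
Qed.

Hypothesis x1 : 1 - x != 0.

Lemma words_eulerianB V : words V = eulerianB x #|V|.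
Proof.
have [m] := ubnP #|V|; elim: m V => // m IHm V /ltnSE lem.
case: (eqVneq V set0) => [->|V0].
  by rewrite (eulerianB_run x1) cards0 /words cards0 word_sum0 /sadd conv_0 mul0r addr0.
rewrite words_split // (eulerianB_run x1) /sadd -sum_subset_conv.
transitivity (\sum_(a | (a.1 \in V) && end_ok true a) words_at V a).
  by apply: eq_bigl => a; rewrite andbT.
rewrite word_sum_run //; congr (_ + _); apply: eq_bigr => U sU.
case: (posnP #|U|) => [->|U0]; first by rewrite /run !mulr0 subrr !mul0r.
have leU := subset_leq_card sU.
have cardD : #|V :\: U| = (#|V| - #|U|)%N by rewrite cardsD (setIidPr sU).
by rewrite /= mulr0n mul0r subr0 IHm cardD //; lia.
Qed.

Lemma word_sum_local_h k : k = n ->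
  word_sum (end_ok false) k setT = conv (geo 1) (local_h x) k.
Proof.
case: k => [|k] kn.
  have -> : setT = set0 :> {set 'I_n}.
    by apply/setP => i; case: i => i lti; exfalso; rewrite -kn in lti.
  by rewrite word_sum0 (local_h_run x1) /sadd conv_0 /ssub subrr mul0r addr0.
have cardT : #|[set: 'I_n]| = k.+1 by rewrite cardsT card_ord.
rewrite word_sum_split.
transitivity (\sum_(a | (a.1 \in [set: 'I_n]) && end_ok false a)
   words_at [set: 'I_n] a).
  apply: eq_bigr => a /andP[aT _]; rewrite /words_at.
  by have := cardsD1 a.1 [set: 'I_n]; rewrite aT cardT => -[->].
rewrite word_sum_run -?card_gt0 cardT // (local_h_run x1) /sadd; congr (_ + _).
rewrite -cardT -sum_subset_conv; apply: eq_bigr => U sU.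
by rewrite words_eulerianB /ssub mul1r cardsD (setIidPr sU).
Qed.

End WordSums.

(** * Signed permutations as tuples of letters *)

Definition signed_tuple (es : {ffun 'I_n -> bool} * {perm 'I_n}) : n.-tuple letter :=
  rev_tuple [tuple (es.2 i, es.1 (es.2 i)) | i < n].

(** The default permutation is used only for tuples with a repeated index, which the sums
    exclude. *)
Definition signed_perm_of (t : n.-tuple letter) : {ffun 'I_n -> bool} * {perm 'I_n} :=
  ([ffun j => (j, true) \in t],
   insubd (1%g : {perm 'I_n}) [ffun i => (tnth (rev_tuple t) i).1]).

Lemma lval_signed_tuple es : map lval (signed_tuple es) = rev (wword es.1 es.2).
Proof. by rewrite /signed_tuple /= map_rev -map_comp. Qed.

Lemma signed_tupleK : cancel signed_tuple signed_perm_of.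
Proof.
move=> [eps s]; congr (_, _).
  apply/ffunP => j; rewrite ffunE mem_rev; apply/mapP/idP => [[i _ [-> <-]]//|epsj].
  by exists ((s^-1)%g j); rewrite ?mem_enum // permKV epsj.
have -> : rev_tuple (signed_tuple (eps, s)) = [tuple (s i, eps (s i)) | i < n].
  by apply/val_inj; rewrite /= revK.
apply/val_inj; rewrite val_insubd.
have -> : [ffun i => (tnth [tuple (s i, eps (s i)) | i < n] i).1] = val s.
  by apply/ffunP => i; rewrite ffunE tnth_mktuple /= -pvalE.
by rewrite (valP s).
Qed.

Lemma signed_perm_ofK (t : n.-tuple letter) :
  perm_eq (unzip1 t) (enum [set: 'I_n]) -> signed_tuple (signed_perm_of t) = t.
Proof.
move=> permt; set r := rev_tuple t.
have inj_r : injective (fun i => (tnth r i).1).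
  have: uniq (map_tuple fst r).
    by rewrite /= map_rev rev_uniq (perm_uniq permt) enum_uniq.
  by move=> /tuple_uniqP inj i j eqij; apply: inj; rewrite !tnth_map.
have sE i : (signed_perm_of t).2 i = (tnth r i).1.
  rewrite -pvalE -[pval _]/(val _) insubdK; first by rewrite ffunE.
  by apply/injectiveP => j k; rewrite !ffunE => /inj_r.
suff e : [tuple ((signed_perm_of t).2 i, (signed_perm_of t).1 ((signed_perm_of t).2 i))
            | i < n] = r.
  by rewrite /signed_tuple e; apply/val_inj; rewrite /= revK.
apply: eq_from_tnth => i.
rewrite tnth_mktuple sE ffunE [RHS]surjective_pairing; congr (_, _).
rewrite -mem_rev -[rev t]/(val r).
case e: (tnth r i) => [j [] /=]; first by rewrite -e mem_tnth.
apply/negbTE/tnthP => -[k ek]; have ik : i = k by apply: inj_r; rewrite e -ek.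
by move: ek; rewrite -ik e.
Qed.

Lemma sum_signed_perm (R : idomainType) (P : pred (seq int)) (F : seq int -> R) :
  \sum_(eps : {ffun 'I_n -> bool}) \sum_(s : {perm 'I_n} | P (rev (wword eps s)))
     F (rev (wword eps s)) =
  \sum_(t : n.-tuple letter | perm_eq (unzip1 t) (enum [set: 'I_n]) && P (map lval t))
     F (map lval t).
Proof.
rewrite pair_big_dep [RHS](reindex_onto signed_tuple signed_perm_of) /=; last first.
  by move=> t /andP[permt _]; apply: signed_perm_ofK.
apply: eq_big => [[eps s]|[eps s] _]; last by rewrite -[rev (wword _ _)]lval_signed_tuple.
rewrite signed_tupleK eqxx andbT -[rev (wword _ _)]lval_signed_tuple.
rewrite (_ : perm_eq _ _ = true) //; apply: uniq_perm.
- rewrite /= /unzip1 map_rev rev_uniq -map_comp map_inj_uniq ?enum_uniq //.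
  exact: perm_inj.
- exact: enum_uniq.
move=> i; rewrite mem_enum inE /unzip1 /= map_rev mem_rev -map_comp.
by apply/mapP; exists ((s^-1)%g i); rewrite ?mem_enum //= permKV.
Qed.

Lemma desB_rdes (eps : {ffun 'I_n -> bool}) (s : {perm 'I_n}) :
  desB eps s = rdes (rev (wword eps s)).
Proof.
have size_w : size (wword eps s) = n by rewrite size_map size_enum_ord.
by rewrite rdes_rev size_w /desB -sum1dep_card big_mkcond.
Qed.

End SignedWords.

Lemma head_rev (T : Type) (z : T) (s : seq T) : head z (rev s) = last z s.
Proof. by case/lastP: s => // s y; rewrite rev_rcons last_rcons. Qed.

Lemma Bplus_local_h (R : idomainType) n :
  Bplus R n = conv (geo 1) (local_h 'X) n.
Proof.
case: n => [|n].
  by rewrite conv_0 /geo expr0 mul1r.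
rewrite -(word_sum_local_h (one_subX_neq0 R) (erefl n.+1)).
transitivity (\sum_(eps : {ffun 'I_n.+1 -> bool})
   \sum_(s : {perm 'I_n.+1} | 0 < head 0 (rev (wword eps s)))
      'X^(rdes (rev (wword eps s))) : {poly R}).
  apply: eq_bigr => eps _; apply: eq_big => s; first by rewrite head_rev.
  by rewrite desB_rdes.
rewrite (sum_signed_perm _ (fun w => 0 < head 0 w) (fun w => 'X^(rdes w) : {poly R})).
apply: eq_bigl => t; congr (_ && _).
by rewrite (tuple_eta t) /= take0 andbT.
Qed.

Lemma Bplus_Bminus (R : idomainType) n :
  Bplus R n + Bminus R n = eulerianB 'X n.
Proof.
case: n => [|n].
  by rewrite addr0 (eulerianB_run (one_subX_neq0 R)) /sadd conv_0 mul0r addr0.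
have := words_eulerianB (one_subX_neq0 R) [set: 'I_n.+1].
rewrite /words cardsT card_ord => <-.
rewrite -big_split /=.
transitivity (\sum_(eps : {ffun 'I_n.+1 -> bool})
   \sum_(s : {perm 'I_n.+1} | predT (rev (wword eps s)))
      'X^(rdes (rev (wword eps s))) : {poly R}).
  apply: eq_bigr => eps _; rewrite [RHS](bigID (fun s => 0 < last 0 (wword eps s))) /=.
  congr (_ + _); apply: eq_big => s; rewrite ?desB_rdes //.
  (* No letter is 0, so a word whose last letter is not positive ends in a negative one. *)
  rewrite -leNgt le_eqVlt; case: eqP => //= e.
  have size_w : size (wword eps s) = n.+1 by rewrite size_map size_enum_ord.
  have : 0 \in wword eps s.
    by move: e size_w; case: (wword eps s) => //= a w <- _; apply: mem_last.
  case/mapP => i _ e0; have := selt_lt0 eps (s i).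
  by have := selt_gt0 eps (s i); rewrite -[selt _ _]e0 ltxx; case: (eps _).
rewrite (sum_signed_perm _ predT (fun w => 'X^(rdes w) : {poly R})).
by apply: eq_bigl => t; rewrite all_predT.
Qed.

(** * The symmetric decomposition *)

Section Decomposition.
Variable R : realFieldType.
Local Notation fplus := (local_h 'X : nat -> {poly R}).
Local Notation fminus := (conv (eulerian 'X) (local_h 'X) : nat -> {poly R}).

Lemma geo1_invol (f : nat -> {poly R}) : conv (conv (geo 1) f) (geo (-1)) = f.
Proof. by rewrite convC convA conv_geo addNr geo0 conv1. Qed.

Lemma binomial_inversion (f : nat -> {poly R}) n :
  \sum_(k < n.+1) (-1) ^+ (n - k) * ('C(n, k))%:R * f k = conv f (geo (-1)) n.
Proof. by apply: eq_bigr => k _; rewrite /geo; ring. Qed.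

Lemma dB_decomposition n : dB R n = fplus n + fminus n.
Proof.
rewrite dB_derange convC (eulerianB_local_h (one_subX_neq0 R)); exact: erefl.
Qed.

Lemma fplus_Bplus n :
  \sum_(k < n.+1) (-1) ^+ (n - k) * ('C(n, k))%:R * Bplus R k = fplus n.
Proof.
rewrite binomial_inversion (functional_extensionality _ _ (@Bplus_local_h R)).
by rewrite geo1_invol.
Qed.

(** Obtained by difference: the inversion of B^+ + B^- is e^(xt) d(2t), the series of d^B, from
    which that of B^+ is removed. *)
Lemma fminus_Bminus n :
  \sum_(k < n.+1) (-1) ^+ (n - k) * ('C(n, k))%:R * Bminus R k = fminus n.
Proof.
apply: (addrI (fplus n)); rewrite -[in LHS]fplus_Bplus -big_split /=.
under eq_bigr => k _ do rewrite -mulrDr.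
rewrite (binomial_inversion (fun k => Bplus R k + Bminus R k)).
rewrite (functional_extensionality _ _ (@Bplus_Bminus R)) /eulerianB geo1_invol.
by rewrite (eulerianB_local_h (one_subX_neq0 R)).
Qed.

Lemma symm_degB m (p q : {poly R}) :
  symm_deg m p -> symm_deg m q -> symm_deg m (p - q).
Proof. by move=> sp sq y y0; rewrite !hornerE sp // sq // mulrBr. Qed.

Lemma symm_decomposition_uniq n (fp fm : {poly R}) :
  dB R n = fp + fm -> symm_deg n fp -> symm_deg n.+1 fm ->
  fp = fplus n /\ fm = fminus n.
Proof.
rewrite dB_decomposition => e sp sm.
(* The left side is symmetric of degree n and the right side of degree n + 1, so both vanish. *)
have diff : fplus n - fp = fm - fminus n.
  by apply/eqP; rewrite subr_eq addrAC eq_sym subr_eq addrC -e addrC.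
have d0 : fplus n - fp = 0.
  apply: (@symm_deg_eq0 _ n).
    by apply: symm_degB => //; apply/gamma_pos_symm/gamma_pos_local_h.
  rewrite diff; apply: symm_degB => //.
  exact/gamma_pos_symm/gamma_pos_eulerian_local_h.
by split; apply/eqP; rewrite -subr_eq0 -?diff ?d0 // -opprB d0 oppr0.
Qed.

End Decomposition.

Theorem theorem1p3 (R : realFieldType) :
  (* f^+_n, f^-_n: unique pair with d^B_n = f^+ + f^-, f^+ symmetric of degree n,
     f^- symmetric of degree n+1; existence, uniqueness and the formulas: *)
  (forall (n : nat) (fp fm : {poly R}),
     (dB R n = fp + fm /\ symm_deg n fp /\ symm_deg n.+1 fm) <->
     (fp = \sum_(k < n.+1) (-1) ^+ (n - k) * ('C(n, k))%:R * Bplus R k /\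
      fm = \sum_(k < n.+1) (-1) ^+ (n - k) * ('C(n, k))%:R * Bminus R k)) /\
  (forall (n : nat) (fp fm : {poly R}), (1 <= n)%N ->
     dB R n = fp + fm -> symm_deg n fp -> symm_deg n.+1 fm ->
     fp = localh_Kn R n /\
     (forall i : nat, 0 <= fp`_i) /\
     (forall i : nat, (i <= n)%N -> fp`_i = fp`_(n - i)) /\
     unimodal_coefs fp).
Proof.
split=> [n fp fm|n fp fm _ e sp sm].
  rewrite fplus_Bplus fminus_Bminus; split=> [[e [sp sm]]|[-> ->]].
    exact: symm_decomposition_uniq.
  split; first exact: dB_decomposition.
  split; apply: gamma_pos_symm; first exact: gamma_pos_local_h.
  exact: gamma_pos_eulerian_local_h.
have [-> _] := symm_decomposition_uniq e sp sm.
have su := gamma_pos_symm_unimodal (gamma_pos_local_h R n).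
split; first by rewrite localh_KnE.
by split; [|split; last exact: symm_unimodal_unimodal su]; case: su.
Qed.
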